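(* Let $M$ be a compact $d$-dimensional smooth manifold and let $E\to M$ be an orientable real vector bundle of rank $k$ equipped with a Riemannian structure. If $n\geq d+k$, then the $n$-Parseval bundle $\mathcal{P}^n(E)\to M$ admits a section; that is, $E$ admits a Parseval frame of size $n$.
   Context: A Riemannian structure on a real vector bundle $E\to M$ is a choice of inner product on each fiber $E_p$, varying smoothly in $p\in M$. For a finite-dimensional real inner product space $V$ of dimension $k$ and $n\ge k$, an $n$-Parseval frame in $V$ is a linear map $A:\mathbb{R}^n\to V$ with $AA^T=I_V$, where $A^T$ is the adjoint with respect to the standard inner product on $\mathbb{R}^n$ and the inner product on $V$; equivalently, a sequence $(f_j)_{j=1}^n$ in $V$ (the images of the standard basis vectors) with $\sum_{j=1}^n|\langle v,f_j\rangle|^2=\|v\|^2$ for all $v\in V$. Let $\mathcal{P}^n(V)$ denote the space of these. The $n$-Parseval bundle $\mathcal{P}^n(E)\to M$ is the fiber subbundle of the vector bundle $\operatorname{Hom}(M\times\mathbb{R}^n,E)$ whose fiber over $p$ is $\mathcal{P}^n(E_p)$. A Parseval frame of size $n$ for $E$ is a smooth section of $\mathcal{P}^n(E)$; equivalently, a collection of $n$ smooth sections $\sigma_1,\dots,\sigma_n$ of $E$ such that $(\sigma_j(p))_{j=1}^n$ is a Parseval frame for $E_p$ for each $p\in M$. *)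

(* Defs.v *)
From HB Require Import structures.
From mathcomp Require Import all_boot all_order all_algebra.
From mathcomp Require Import all_classical all_reals all_analysis.

Set Implicit Arguments.
Unset Strict Implicit.
Unset Printing Implicit Defensive.

Import Order.TTheory GRing.Theory Num.Theory.
Import numFieldNormedType.Exports.

Local Open Scope classical_set_scope.
Local Open Scope ring_scope.

Section EuclideanSmoothness.
Context {R : realType} {d : nat}.

(* [U] is meant to be open; the values of [f] outside [U] are irrelevant. *)
Fixpoint Ck_on (r : nat) (U : set 'rV[R]_d) (f : 'rV[R]_d -> R) : Prop :=
  (forall x, U x -> {for x, continuous f}) /\
  if r is r'.+1 then
    forall i : 'I_d, (forall x, U x -> derivable f x (delta_mx 0 i)) /\
                     Ck_on r' U (fun x => 'D_(delta_mx 0 i) f x)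
  else True.

Definition smooth_on (U : set 'rV[R]_d) (f : 'rV[R]_d -> R) : Prop :=
  forall r, Ck_on r U f.

Definition smooth_mx_on m n (U : set 'rV[R]_d) (F : 'rV[R]_d -> 'M[R]_(m, n)) :=
  forall i j, smooth_on U (fun x => F x i j).

Lemma Ck_on_cst r U (c : R) : Ck_on r U (cst c).
Proof.
elim: r c => [|r IH] c; (split; first by move=> x _; exact: cst_continuous) => //.
move=> i.
split=> [x _|]; first exact: derivable_cst.
by have := IH 0; congr (Ck_on _ _ _); apply/funext => x; rewrite derive_cst.
Qed.

Lemma Ck_on_ext r U (f g : 'rV[R]_d -> R) : open U ->
  (forall x, U x -> f x = g x) -> Ck_on r U f -> Ck_on r U g.
Proof.
move=> oU; have near_fg (h k : 'rV[R]_d -> R) x :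
    (forall y, U y -> h y = k y) -> U x -> \near x, h x = k x.
  by move=> hk Ux; near=> y; apply: hk; near: y; exact: open_nbhs_nbhs.
have cont_ext (h k : 'rV[R]_d -> R) : (forall y, U y -> h y = k y) ->
    (forall x, U x -> {for x, continuous h}) ->
    forall x, U x -> {for x, continuous k}.
  move=> hk hc x Ux; rewrite /prop_for /continuous_at -(hk x Ux).
  exact: cvg_trans (near_eq_cvg (near_fg _ _ _ hk Ux)) (hc x Ux).
elim: r f g => [|r IH] f g fg /= [fc fd]; split => //; try exact: cont_ext fc.
move=> i; have [fi fD] := fd i.
split=> [x Ux|].
  by apply: near_eq_derivable (fi x Ux) => //; exact: near_fg.
by apply: IH fD => x Ux; apply: near_eq_derive => //; exact: near_fg.
Unshelve. all: by end_near. Qed.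

End EuclideanSmoothness.

(* Only the restrictions of [chart_fun] and [chart_inv] to [chart_dom] and
   [chart_img] are meaningful. *)
Record chart (R : realType) (M : topologicalType) (d : nat) := Chart {
  chart_dom : set M;
  chart_img : set 'rV[R]_d;
  chart_fun :> M -> 'rV[R]_d;
  chart_inv : 'rV[R]_d -> M;
  chart_dom_open : open chart_dom;
  chart_img_open : open chart_img;
  chart_funP : forall p, chart_dom p ->
    chart_img (chart_fun p) /\ chart_inv (chart_fun p) = p;
  chart_invP : forall x, chart_img x ->
    chart_dom (chart_inv x) /\ chart_fun (chart_inv x) = x;
  chart_fun_continuous : forall p, chart_dom p -> {for p, continuous chart_fun};
  chart_inv_continuous : forall x, chart_img x -> {for x, continuous chart_inv}
}.

(* The subset of R^d corresponding to [U] in the chart [c]. *)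
Definition chart_trace (R : realType) (M : topologicalType) d
    (c : chart R M d) (U : set M) : set 'rV[R]_d :=
  chart_img c `&` chart_inv c @^-1` U.

Record smooth_manifold (R : realType) (d : nat) := SmoothManifold {
  carrier :> topologicalType;
  manifold_hausdorff : hausdorff_space carrier;
  manifold_second_countable : @second_countable carrier;
  atlas : set (chart R carrier d);
  atlas_cover : forall p, exists2 c, atlas c & chart_dom c p;
  atlas_compat : forall c c', atlas c -> atlas c' ->
    smooth_mx_on (chart_trace c (chart_dom c')) (c' \o chart_inv c)
}.

Section ManifoldSmoothness.
Context {R : realType} {d : nat} {M : smooth_manifold R d}.

Definition smooth_fun (U : set M) (f : M -> R) : Prop :=
  forall c : chart R M d, atlas c -> smooth_on (chart_trace c U) (f \o chart_inv c).

Definition smooth_mx m n (U : set M) (F : M -> 'M[R]_(m, n)) : Prop :=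
  forall i j, smooth_fun U (fun p => F p i j).

Lemma chart_trace_open (c : chart R M d) (U : set M) :
  open U -> open (chart_trace c U).
Proof.
move=> oU; rewrite openE => x [cx Ux]; apply: filterI.
  by apply: open_nbhs_nbhs; split => //; exact: chart_img_open.
by apply: (chart_inv_continuous cx); exact: open_nbhs_nbhs.
Qed.

Lemma smooth_fun_cst (U : set M) (a : R) : smooth_fun U (cst a).
Proof. by move=> c _ r; exact: Ck_on_cst. Qed.

Lemma smooth_fun_ext (U : set M) (f g : M -> R) : open U ->
  (forall p, U p -> f p = g p) -> smooth_fun U f -> smooth_fun U g.
Proof.
move=> oU fg sf c cA r; apply: Ck_on_ext (sf c cA r).
  exact: chart_trace_open.
by move=> x [_ Ux]; exact: fg.
Qed.

End ManifoldSmoothness.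

(* A local trivialization over [triv_dom] of a family of vector spaces [E]:
   only the maps [triv_fun p] with [p] in [triv_dom] are meaningful. *)
Record trivialization (R : realType) (M : topologicalType)
    (E : M -> vectType R) (k : nat) := Trivialization {
  triv_dom : set M;
  triv_fun :> forall p, 'Hom(E p, 'rV[R]_k);
  triv_dom_open : open triv_dom;
  triv_bij : forall p, triv_dom p -> bijective (triv_fun p)
}.

(* With R^k made of row vectors, [t p v = s p v *m transition s t p]. *)
Definition transition (R : realType) (M : topologicalType)
    (E : M -> vectType R) k (s t : trivialization E k) (p : M) : 'M[R]_k :=
  \matrix_(i, j) t p ((s p)^-1%VF (delta_mx 0 i)) 0 j.

Definition triv_compat (R : realType) d (M : smooth_manifold R d)
    (E : M -> vectType R) k (s t : trivialization E k) : Prop :=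
  smooth_mx (triv_dom s `&` triv_dom t) (transition s t).

(* The bundle is given by its fibers together with smoothly compatible local
   trivializations; these determine the topology and the smooth structure of
   the total space {p : M & fiber p}. *)
Record vector_bundle (R : realType) (d : nat) (M : smooth_manifold R d)
    (k : nat) := VectorBundle {
  fiber :> M -> vectType R;
  triv : set (trivialization fiber k);
  triv_cover : forall p, exists2 t, triv t & triv_dom t p;
  triv_atlas_compat : forall s t, triv s -> triv t -> triv_compat s t
}.

Section Bundles.
Context {R : realType} {d : nat} {M : smooth_manifold R d} {k : nat}.
Variable E : vector_bundle M k.

Definition smooth_section (sigma : forall p, E p) : Prop :=
  forall t : trivialization E k, triv t ->
    smooth_mx (triv_dom t) (fun p => t p (sigma p)).

Definition orientable : Prop :=
  exists O : set (trivialization E k),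
    [/\ forall p, exists2 t, O t & triv_dom t p,
        forall s t, O s -> triv t -> triv_compat s t /\ triv_compat t s &
        forall s t, O s -> O t -> forall p, triv_dom s p -> triv_dom t p ->
          0 < \det (transition s t p)].

Record riemannian_structure := RiemannianStructure {
  metric :> forall p, {dot (E p) for idfun};
  metric_smooth : forall t : trivialization E k, triv t ->
    forall x y : 'rV[R]_k, smooth_fun (triv_dom t)
      (fun p => metric p ((t p)^-1%VF x) ((t p)^-1%VF y))
}.

End Bundles.

Section HomBundle.
Context {R : realType} {d : nat} {M : smooth_manifold R d} {k : nat}.
Variables (n : nat) (E : vector_bundle M k).

Definition hom_fiber (p : M) : vectType R := 'Hom('rV[R]_n, E p).

(* [hom_bundle n E] is Hom(M x R^n, E): a map [A : R^n -> E_p] is trivialized as the n x k matrix of [t p \o A]. *)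
Definition hom_triv_fun (t : trivialization E k) (p : M) (A : hom_fiber p) :
    'rV[R]_(n * k) :=
  mxvec (\matrix_i t p (A (delta_mx 0 i))).

Lemma hom_triv_fun_linear t p : linear (@hom_triv_fun t p).
Proof.
move=> a A B; rewrite /hom_triv_fun -linearP; congr mxvec.
by apply/matrixP => i j; rewrite !mxE !lfunE /= lfunE /= linearP !mxE.
Qed.

HB.instance Definition _ t p :=
  GRing.isLinear.Build R (hom_fiber p) 'rV[R]_(n * k) *:%R (@hom_triv_fun t p)
    (@hom_triv_fun_linear t p).

Lemma hom_triv_bij (t : trivialization E k) p : triv_dom t p ->
  bijective (linfun (@hom_triv_fun t p)).
Proof.
move=> /triv_bij tbij; have tK : lker (t p) == 0%VS by apply/lker0P; exact: bij_inj.
have tVK x : t p ((t p)^-1%VF x) = x.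
  by have [g _ tg] := tbij; rewrite -{1}(tg x) lker0_lfunK// tg.
pose g (w : 'rV[R]_(n * k)) : hom_fiber p :=
  ((t p)^-1 \o linfun (mulmxr (vec_mx w)))%VF.
exists g => [A|w].
  apply/lfunP => x; rewrite /g comp_lfunE !lfunE /= mxvecK.
  rewrite -[RHS](lker0_lfunK tK); congr ((t p)^-1%VF _).
  rewrite [in RHS](row_sum_delta x) !linear_sum /= mulmx_sum_row.
  by apply: eq_bigr => i _; rewrite !linearZ rowK.
rewrite lfunE /= /hom_triv_fun -[RHS]vec_mxK; congr mxvec.
by apply/row_matrixP => i; rewrite rowK /g comp_lfunE tVK lfunE /= -rowE.
Qed.

Definition hom_triv (t : trivialization E k) : trivialization hom_fiber (n * k) :=
  {| triv_dom := triv_dom t;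
     triv_fun p := linfun (@hom_triv_fun t p);
     triv_dom_open := @triv_dom_open _ _ _ _ t;
     triv_bij := hom_triv_bij (t := t) |}.

Lemma transition_hom_triv (s t : trivialization E k) p a b a' b' :
  triv_dom s p ->
  transition (hom_triv s) (hom_triv t) p (mxvec_index a b) (mxvec_index a' b') =
  if a' == a then transition s t p b b' else 0.
Proof.
move=> sp; have sbij := triv_bij sp.
have sK : lker (s p) == 0%VS by apply/lker0P; exact: bij_inj.
have [g gK Kg] := hom_triv_bij sp.
rewrite !mxE /= lfunE /= /hom_triv_fun mxvecE mxE.
set A := (_^-1)%VF _.
have sA : \matrix_i s p (A (delta_mx 0 i)) = delta_mx a b.
  apply: (can_inj (@mxvecK _ _ _)); rewrite mxvec_delta.
  have -> : A = g (delta_mx 0 (mxvec_index a b)).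
    rewrite /A -{1}[delta_mx _ _]Kg lker0_lfunK//.
    by apply/lker0P; exact: can_inj gK.
  by have := Kg (delta_mx 0 (mxvec_index a b)); rewrite lfunE.
have {}sA : s p (A (delta_mx 0 a')) = if a' == a then delta_mx 0 b else 0.
  have /(congr1 (row a')) := sA; rewrite rowK => ->.
  by apply/rowP => j; rewrite !mxE; case: eqP; rewrite !mxE.
rewrite -[A _](lker0_lfunK sK) sA; case: eqP => _; first by [].
by rewrite !linear0 mxE.
Qed.

Lemma hom_triv_cover p : exists2 T, [set hom_triv t | t in triv (v := E)] T &
  triv_dom T p.
Proof.
have [t tE tp] := triv_cover E p.
by exists (hom_triv t) => //; exists t.
Qed.

Lemma hom_triv_compat S T : [set hom_triv t | t in triv (v := E)] S ->
  [set hom_triv t | t in triv (v := E)] T -> triv_compat S T.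
Proof.
move=> [s sE <-] [t tE <-].
have oU : open (triv_dom s `&` triv_dom t).
  by apply: openI; exact: triv_dom_open.
case/mxvec_indexP => a b; case/mxvec_indexP => a' b' /=.
have [aa'|aa'] := boolP (a' == a).
  apply: (smooth_fun_ext oU) (triv_atlas_compat sE tE b b').
  by move=> p [sp _]; rewrite transition_hom_triv// aa'.
apply: (smooth_fun_ext oU) (smooth_fun_cst _ 0).
by move=> p [sp _]; rewrite transition_hom_triv// (negbTE aa').
Qed.

Definition hom_bundle : vector_bundle M (n * k) :=
  VectorBundle hom_triv_cover hom_triv_compat.

End HomBundle.

Section Parseval.
Context {R : realType} {V : vectType R} (g : {dot V for idfun}) (n : nat).

Definition adjoint (A : 'Hom('rV[R]_n, V)) (B : 'Hom(V, 'rV[R]_n)) : Prop :=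
  forall x v, g (A x) v = \sum_(j < n) x 0 j * B v 0 j.

Definition parseval_space : set 'Hom('rV[R]_n, V) :=
  [set A | exists2 AT, adjoint A AT & (A \o AT)%VF = \1%VF].

Definition parseval_frame (f : 'I_n -> V) : Prop :=
  forall v, \sum_(j < n) `|g v (f j)| ^+ 2 = g v v.

End Parseval.
Arguments parseval_space {R V} g n _.

(* The fibers of P^n(E), as subsets of the fibers of Hom(M x R^n, E). *)
Definition parseval_bundle (R : realType) d (M : smooth_manifold R d) k
    (E : vector_bundle M k) (g : riemannian_structure E) (n : nat)
    (p : M) : set (hom_bundle n E p) :=
  parseval_space (g p) n.

(* Main.v *)
(* A projection argument in the spirit of the easy Whitney embedding theorem.
   Local orthonormal frames, glued by bump functions on the compact base, give a
   Parseval frame f_1, ..., f_N of E for some large N.  As long as N > d + k, the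
   vectors (<v, f_i(p)>)_i of R^N, with p in M and v in E_p, depend on d + k real
   parameters in a locally Lipschitz way, so they cannot cover R^N: of the m^N
   integer points of a cube of side m they reach only O(m^(d+k)).  A unit vector u
   that is missed satisfies |a| < 1 for the section a = sum_i u_i f_i.  Expressing
   the frame in an orthonormal basis of R^N that starts with u and dropping the
   first vector, which is a, leaves N - 1 sections with frame operator
   1 - a a^T.  This is invertible, with the smooth inverse square root
   1 + c a a^T for an explicit scalar function c of |a|^2, which restores the
   Parseval identity with one vector less. *)
Require Import Defs.
From HB Require Import structures.
From mathcomp Require Import all_boot all_order all_algebra.
From mathcomp Require Import all_classical all_reals all_analysis.
From mathcomp Require Import ring lra.

Set Implicit Arguments.
Unset Strict Implicit.
Unset Printing Implicit Defensive.

Import Order.TTheory GRing.Theory Num.Theory.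
Import numFieldNormedType.Exports.

Local Open Scope classical_set_scope.
Local Open Scope ring_scope.

(** * Smooth functions on Euclidean space *)

(** The difference quotient along [v] is literally that of the slice [s |-> f (x + s *: v)]. With
    the converse below, directional derivatives become one-variable derivatives, to which the chain
    rule and the mean value theorem apply. *)
Lemma is_derive_slice (R : realType) (V : normedModType R) (f : V -> R)
    (x v : V) (t df : R) :
  is_derive (x + t *: v) v f df ->
  is_derive t 1 (fun s => f (x + s *: v)) df.
Proof.
have E : (fun h => h^-1 *: ((f \o shift (x + t *: v)) (h *: v) -
      f (x + t *: v))) =
    (fun h : R => h^-1 *: (((fun s => f (x + s *: v)) \o shift t) (h *: 1) -
      f (x + t *: v))).
  apply/funext => h /=; congr (_ *: (f _ - _)).
  by rewrite [h *: 1]mulr1 scalerDl [RHS]addrCA.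
case=> fd fE; split; first by move: fd; rewrite /derivable E.
by rewrite -fE /derive E.
Qed.

Lemma slice_is_derive (R : realType) (V : normedModType R) (f : V -> R)
    (x v : V) (df : R) :
  is_derive (0 : R) 1 (fun s => f (x + s *: v)) df -> is_derive x v f df.
Proof.
have E : (fun h => h^-1 *: ((f \o shift x) (h *: v) - f x)) =
    (fun h : R => h^-1 *: (((fun s => f (x + s *: v)) \o shift 0) (h *: 1) -
      f (x + 0 *: v))).
  apply/funext => h /=; rewrite addr0 [h *: 1]mulr1 scale0r addr0.
  by rewrite (addrC x).
case=> fd fE; split; first by move: fd; rewrite /derivable E.
by rewrite -fE /derive E.
Qed.

Lemma is_derive_comp_dir (R : realType) (V : normedModType R) (f : V -> R)
    (h : R -> R) (x v : V) (df dh : R) :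
  is_derive x v f df -> is_derive (f x) 1 h dh ->
  is_derive x v (h \o f) (dh * df).
Proof.
move=> fd hd; apply: slice_is_derive.
have fd' : is_derive (0 : R) 1 (fun s => f (x + s *: v)) df.
  by apply: is_derive_slice; rewrite scale0r addr0.
apply: (@is_derive1_comp _ h (fun s => f (x + s *: v))) => //.
by rewrite scale0r addr0.
Qed.

Section EuclideanCalculus.
Context {R : realType} {d : nat}.
Implicit Types (U V : set 'rV[R]_d) (f g : 'rV[R]_d -> R).

(** Every clause of [Ck_on] is a condition at single points of the set, with limits taken in the
    whole space, so the sets [V] may vary with the point. *)
Lemma Ck_on_pointwise r U f :
  (forall x, U x -> exists2 V, V x & Ck_on r V f) -> Ck_on r U f.
Proof.
elim: r f => [|r IH] f H /=; split.
- by move=> x /H[V Vx [+ _]]; apply.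
- by [].
- by move=> x /H[V Vx [+ _]]; apply.
move=> i; split; first by move=> x /H[V Vx [_ /(_ i) [+ _]]]; apply.
by apply: IH => x /H[V Vx [_ /(_ i)[_ ?]]]; exists V.
Qed.

Lemma Ck_onW r U f : Ck_on r.+1 U f -> Ck_on r U f.
Proof.
elim: r f => [|r IH] f; first by case.
case=> fc fd; split=> // i; have [? fD] := fd i; split=> //.
exact: IH.
Qed.

Lemma Ck_on_eq r U f g : open U -> Ck_on r U f -> {in U, f =1 g} ->
  Ck_on r U g.
Proof.
by move=> oU fU fg; apply: Ck_on_ext fU => // x Ux; exact/fg/mem_set.
Qed.

Lemma Ck_on_add r U f g : open U -> Ck_on r U f -> Ck_on r U g ->
  Ck_on r U (f \+ g).
Proof.
move=> oU; elim: r f g => [|r IH] f g [fc fd] [gc gd]; split=> //.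
- by move=> x Ux; exact: (continuousD (fc x Ux) (gc x Ux)).
- by move=> x Ux; exact: (continuousD (fc x Ux) (gc x Ux)).
move=> i; have [fi fD] := fd i; have [gi gD] := gd i.
split=> [x Ux|]; first by apply: derivableD; [exact: fi|exact: gi].
apply: (Ck_on_eq oU (IH _ _ fD gD)) => x; rewrite inE => Ux.
by rewrite /= deriveD//; [exact: fi|exact: gi].
Qed.

Lemma Ck_on_mul r U f g : open U -> Ck_on r U f -> Ck_on r U g ->
  Ck_on r U (f \* g).
Proof.
move=> oU; elim: r f g => [|r IH] f g [fc fd] [gc gd]; split=> //.
- by move=> x Ux; exact: (continuousM (fc x Ux) (gc x Ux)).
- by move=> x Ux; exact: (continuousM (fc x Ux) (gc x Ux)).
move=> i; have [fi fD] := fd i; have [gi gD] := gd i.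
have [fr gr] : Ck_on r U f /\ Ck_on r U g by split; apply: Ck_onW.
split=> [x Ux|]; first by apply: derivableM; [exact: fi|exact: gi].
apply: (Ck_on_eq oU (Ck_on_add oU (IH _ _ fr gD) (IH _ _ gr fD))) => x.
by rewrite inE => Ux; rewrite /= deriveM//; [exact: fi|exact: gi].
Qed.

(** The induction on [r] closes because [H] is stable under differentiation: the partial derivative
    of [h \o f] is [h' \o f] times that of [f], with [h'] again in [H]. *)
Lemma Ck_on_comp (I : set R) (H : set (R -> R)) :
  (forall h, H h -> exists2 h', H h' &
     forall x, I x -> is_derive x 1 h (h' x)) ->
  forall r U f h, open U -> (forall x, U x -> I (f x)) ->
  H h -> Ck_on r U f -> Ck_on r U (h \o f).
Proof.
move=> HD r U f h oU fI; elim: r h => [|r IH] h Hh fr.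
all: have [h' Hh' hh'] := HD _ Hh.
all: have hc x : U x -> {for x, continuous (h \o f)}.
1,3: move=> Ux; apply: continuous_comp; first by case: fr => + _; apply.
1,2: apply: differentiable_continuous; apply/derivable1_diffP.
1,2: by have := hh' _ (fI _ Ux); case.
- by split.
split=> // i; have [_ /(_ i)[fi fD]] := fr.
have E x : U x ->
    is_derive x (delta_mx 0 i) (h \o f) (h' (f x) * 'D_(delta_mx 0 i) f x).
  move=> Ux; apply: is_derive_comp_dir; last exact: hh' (fI _ Ux).
  by apply: DeriveDef => //; exact: fi.
split=> [x Ux|]; first by have [] := E _ Ux.
have fr' : Ck_on r U f by exact: Ck_onW.
apply: (Ck_on_eq oU (Ck_on_mul oU (IH _ Hh' fr') fD)) => x.
by rewrite inE => Ux; have [_ ->] := E _ Ux.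
Qed.

End EuclideanCalculus.

(* The polynomial factor makes this family closed under differentiation. *)
Definition flat (R : realType) (p : {poly R}) (t : R) : R :=
  if 0 < t then p.[t^-1] * expR (- t^-1) else 0.

(** From [1 + x^(i+1) / (i+1)! <= expR x] at [x = 1/t], each monomial satisfies
    [t^-i * expR (- 1/t) <= (i+1)! * t] for [t > 0]. *)
Lemma flat_le (R : realType) (p : {poly R}) :
  exists2 C, 0 <= C & forall t, `|flat p t| <= C * `|t|.
Proof.
exists (\sum_(i < size p) `|p`_i| * i.+1`!%:R).
  by apply: sumr_ge0 => i _; rewrite mulr_ge0.
move=> t; rewrite /flat; case: ifPn => t0; last first.
  by rewrite normr0 mulr_ge0// sumr_ge0// => i _; rewrite mulr_ge0.
rewrite horner_coef !mulr_suml (le_trans (ler_norm_sum _ _ _))//.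
apply: ler_sum => i _; rewrite 2!normrM -!mulrA ler_wpM2l//.
rewrite (gtr0_norm t0) ger0_norm ?exprn_ge0 ?invr_ge0 ?(ltW t0)//.
rewrite (ger0_norm (expR_ge0 _)) expRN ler_pdivrMr ?expR_gt0//.
have ti : 0 <= t^-1 by rewrite invr_ge0 ltW.
have := expR_ge1Dxn i ti; set e := expR _; set F := _%:R => H.
have F0 : 0 < F by rewrite ltr0n fact_gt0.
have : t^-1 ^+ i.+1 / F <= e by apply: le_trans H; rewrite lerDr.
rewrite ler_pdivrMr// => H2.
have -> : t^-1 ^+ i = t * t^-1 ^+ i.+1.
  by rewrite exprS mulrA divff ?mul1r ?gt_eqF.
by rewrite -mulrA mulrCA ler_wpM2l ?(ltW t0)// mulrC.
Qed.

Lemma flat_is_derive (R : realType) (p : {poly R}) (t : R) :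
  is_derive t 1 (flat p) (flat ((p - p^`()) * 'X^2) t).
Proof.
case: (ltrgt0P t) => t0.
- have tn0 : t != 0 by rewrite gt_eqF.
  refine (@near_eq_is_derive R R R
    (fun s : R => p.[s^-1] * expR (- s^-1)) _ _ _ _ _ _).
    by near=> s; rewrite /flat ifT//; near: s; exact: lt_nbhsr.
  have dI : is_derive t 1 (fun s : R => s^-1) (- t ^- 2).
    have := @is_deriveV R id t 1 1 tn0 (is_derive_id t 1).
    by rewrite [_ *: 1]mulr1.
  have dP := @is_derive1_comp R (horner p) _ t _ _ (is_derive_poly p t^-1) dI.
  have dE := @is_derive1_comp R expR _ t _ _ (is_derive_expR (- t^-1))
    (is_deriveN dI).
  have := is_deriveM dP dE; move/is_derive_eq; apply.
  rewrite /flat t0 !hornerE /= /GRing.scale /=.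
  by field.
- apply: (@near_eq_is_derive _ _ _ (cst 0)).
    near=> s; rewrite /flat ifF//; apply/negbTE; rewrite -leNgt ltW//.
    by near: s; exact: lt_nbhsl.
  by rewrite /flat ltNge (ltW t0) /=; exact: is_derive_cst.
- rewrite t0 /flat ltxx -/(flat _).
  (* The difference quotient of [flat p] at [0] is [flat (p * 'X)], which the linear bound sends to
     [0]. *)
  have [C C0 HC] := flat_le (p * 'X).
  have E h : h^-1 *: (flat p (h *: 1 + 0) - flat p 0) = flat (p * 'X) h.
    rewrite addr0 /flat ltxx subr0 [_ *: 1]mulr1; case: ifP => h0;
      last by rewrite scaler0.
    by rewrite hornerMX /GRing.scale /=; ring.
  have L : (fun h => h^-1 *: (flat p (h *: 1 + 0) - flat p 0)) @ 0^' --> (0 : R).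
    rewrite (_ : (fun h => _) = flat (p * 'X)); last exact/funext.
    apply: cvg_within_filter; apply/cvgr0Pnorm_le => e e0.
    have C1 : 0 < C + 1 by rewrite ltr_wpDl.
    have eC : 0 < e / (C + 1) by rewrite divr_gt0.
    apply: filterS (nbhs0_le (V := R) eC) => h hle.
    apply: (le_trans (HC h)).
    rewrite (le_trans (ler_wpM2l C0 hle))// mulrCA ger_pMr//.
    rewrite ler_pdivrMr// mul1r.
    by rewrite lerDl.
  split; first by apply/cvg_ex; exists 0.
  exact: cvg_lim L.
Unshelve. all: by end_near. Qed.

Section SmoothCompositions.
Context {R : realType} {d : nat}.
Implicit Types (U V : set 'rV[R]_d) (f g : 'rV[R]_d -> R).

Lemma smooth_on_flat U f : open U -> smooth_on U f ->
  smooth_on U (flat 1 \o f).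
Proof.
move=> oU sf r; apply: (@Ck_on_comp _ _ setT (range (@flat R))) => //.
move=> _ [p _ <-]; exists (flat ((p - p^`()) * 'X^2)).
  by exists ((p - p^`()) * 'X^2).
by move=> t _; exact: flat_is_derive.
Qed.

Lemma smooth_on_powR a U f : open U -> (forall x, U x -> 0 < f x) ->
  smooth_on U f -> smooth_on U (fun x => f x `^ a).
Proof.
move=> oU f0 sf r.
(* Multiples of powers form a family closed under differentiation on the positive half-line. *)
pose H := [set h : R -> R | exists c a, h = (fun x => c * x `^ a)].
have -> : (fun x => f x `^ a) = (fun x => 1 * x `^ a) \o f.
  by apply/funext => x /=; rewrite mul1r.
apply: (@Ck_on_comp _ _ [set x | 0 < x] H) => //; last by exists 1, a.
move=> _ [c [b ->]]; exists (fun x => c * b * x `^ (b - 1)).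
  by exists (c * b), (b - 1).
move=> x /= x0; rewrite -mulrA; have := is_derive1_powR b x0.
by move/(@is_deriveZ _ _ _ _ c).
Qed.

Lemma mx_norm_coord (x : 'rV[R]_d) j : `|x 0 j| <= `|x|.
Proof.
rewrite [leRHS]/Num.norm /= mx_normrE.
exact: (@le_bigmax_cond _ _ _ 0 (0, j) xpredT (fun i => `|x i.1 i.2|) isT).
Qed.

Lemma mx_norm_lt (x : 'rV[R]_d) (r : R) : 0 < r ->
  (forall j, `|x 0 j| < r) -> `|x| < r.
Proof.
move=> r0 H; rewrite /Num.norm /= mx_normrE.
by apply: bigmax_lt => // -[i j] _ /=; rewrite ord1.
Qed.

Lemma mx_norm_le (x : 'rV[R]_d) (r : R) : 0 <= r ->
  (forall j, `|x 0 j| <= r) -> `|x| <= r.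
Proof.
move=> r0 H; rewrite /Num.norm /= mx_normrE.
by apply: bigmax_le => // -[i j] _ /=; rewrite ord1.
Qed.

(** Go from [y] to [x] by changing one coordinate at a time. Each move is parallel to an axis, where
    the mean value theorem and a local bound on the partial derivatives apply. *)
Lemma Ck_on_lipschitz U f x0 : open U -> Ck_on 1 U f -> U x0 ->
  exists r L, [/\ 0 < r, 0 <= L, forall x, `|x - x0| < r -> U x &
    forall x y, `|x - x0| < r -> `|y - x0| < r ->
      `|f x - f y| <= L * `|x - y| ].
Proof.
move=> oU [fc fd] Ux0.
(* By continuity each partial derivative stays within 1 of its value at [x0]; the sum bounds all of
   them at once. *)
pose B := \sum_(i < d) (`|'D_(delta_mx 0 i) f x0| + 1).
have B0 : 0 <= B by apply: sumr_ge0 => i _; rewrite addr_ge0.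
have nB : \forall x \near x0, U x /\ forall i, `|'D_(delta_mx 0 i) f x| <= B.
  suff H : \forall x \near x0, forall i, `|'D_(delta_mx 0 i) f x| <= B.
    by apply: filterI H; exact: open_nbhs_nbhs.
  refine (@filter_forall _ 'I_d
    (fun i x => `|'D_(delta_mx 0 i) f x| <= B) (nbhs x0) _ _) => i.
  have [_ [Dc _]] := fd i; have Dc0 := Dc x0 Ux0.
  have : \forall x \near x0,
      `|'D_(delta_mx 0 i) f x0 - 'D_(delta_mx 0 i) f x| < 1.
    by move/cvgrPdist_lt : Dc0; apply.
  apply: filterS => x H.
  have : `|'D_(delta_mx 0 i) f x| <= `|'D_(delta_mx 0 i) f x0| + 1.
    rewrite -(ltrD2l `|'D_(delta_mx 0 i) f x0|) in H.
    have := ler_distD ('D_(delta_mx 0 i) f x0) 0 ('D_(delta_mx 0 i) f x).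
    by rewrite !sub0r !normrN; move: H; lra.
  move=> /le_trans; apply; rewrite /B (bigD1 i)//= lerDl.
  by apply: sumr_ge0 => j _; rewrite addr_ge0.
have /nbhs_normP[r /= r0 rB] := nB.
have Br x i : `|x - x0| < r -> `|'D_(delta_mx 0 i) f x| <= B.
  by rewrite distrC => /rB[_]; apply.
have Ur x : `|x - x0| < r -> U x by rewrite distrC => /rB[].
have step z i s : 0 <= s ->
    `|z - x0| < r -> `|z + s *: delta_mx 0 i - x0| < r ->
    `|f (z + s *: delta_mx 0 i) - f z| <= B * s.
  move=> s0 zr zsr.
  (* A ball of the max norm is a box, so it contains the axis-parallel segment between two of its
     points. *)
  have tr t : 0 <= t <= s -> `|z + t *: delta_mx 0 i - x0| < r.
    move=> /andP[t0 ts]; apply: mx_norm_lt => // j.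
    have := le_lt_trans (mx_norm_coord _ j) zr.
    have := le_lt_trans (mx_norm_coord _ j) zsr.
    rewrite !mxE /= !ltr_norml; case: eqP => _ /=; rewrite ?mulr1 ?mulr0; lra.
  pose phi t := f (z + t *: delta_mx 0 i).
  have dphi t : 0 <= t <= s ->
      is_derive t 1 phi ('D_(delta_mx 0 i) f (z + t *: delta_mx 0 i)).
    move=> /tr/Ur Ut; apply: is_derive_slice; apply: DeriveDef => //.
    by have [+ _] := fd i; apply.
  have [| |c] := @MVT_segment R phi
      (fun t => 'D_(delta_mx 0 i) f (z + t *: delta_mx 0 i)) 0 s s0.
  - by move=> t; rewrite in_itv /= => /andP[t0 ts]; apply: dphi; rewrite !ltW.
  - apply: derivable_within_continuous => t; rewrite in_itv /= => ts.
    by have [] := dphi t ts.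
  rewrite in_itv /= => /tr cs; rewrite {1}/phi {1}/phi scale0r addr0 subr0 => ->.
  by rewrite normrM (ger0_norm s0) ler_wpM2r// Br.
have step' z z' i : `|z - x0| < r -> `|z' - x0| < r ->
    z' = z + (z' 0 i - z 0 i) *: delta_mx 0 i ->
    `|f z' - f z| <= B * `|z' 0 i - z 0 i|.
  move=> zr zr'; case: (lerP 0 (z' 0 i - z 0 i)) => s0 E.
    by rewrite (ger0_norm s0) {1}E; apply: step; rewrite -?E.
  have E' : z = z' + (z 0 i - z' 0 i) *: delta_mx 0 i.
    by rewrite {1}E -addrA -scalerDl addrA subrK subrr scale0r addr0.
  have s0' : 0 <= z 0 i - z' 0 i by lra.
  rewrite distrC (distrC (z' 0 i)) (ger0_norm s0').
  by rewrite {1}E'; apply: step; rewrite -?E'.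
exists r, (d%:R * B); split=> //; first by rewrite mulr_ge0.
move=> x y xr yr.
(* [z k] has the first [k] coordinates of [x] and the remaining ones of [y]; it stays in the box. *)
pose z k : 'rV[R]_d := \row_j if (j < k)%N then x 0 j else y 0 j.
have zr k : `|z k - x0| < r.
  apply: mx_norm_lt => // j; rewrite !mxE; case: ifP => _.
    by have := le_lt_trans (mx_norm_coord _ j) xr; rewrite !mxE.
  by have := le_lt_trans (mx_norm_coord _ j) yr; rewrite !mxE.
have H k : (k <= d)%N -> `|f (z k) - f y| <= k%:R * B * `|x - y|.
  elim: k => [_|k IH kd].
    suff -> : z 0 = y by rewrite subrr normr0 !mul0r.
    by apply/rowP => j; rewrite mxE.
  have := ler_distD (f (z k)) (f (z k.+1)) (f y).
  move/le_trans; apply; rewrite -natr1 !mulrDl addrC lerD ?IH ?(ltnW kd)//.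
  pose i := Ordinal kd.
  have E j : z k.+1 0 j - z k 0 j = if j == i then x 0 i - y 0 i else 0.
    rewrite !mxE ltnS leq_eqVlt -(inj_eq val_inj) /=.
    case: eqP => [ji|_] /=; last by rewrite subrr.
    by rewrite ji ltnn (_ : j = i)//; exact: val_inj.
  have E2 : z k.+1 = z k + (z k.+1 0 i - z k 0 i) *: delta_mx 0 i.
    apply/rowP => j; rewrite E eqxx; have := E j.
    set z1 := z k.+1; set z0 := z k; rewrite !mxE eqxx /=.
    by case: eqP => _ /=; rewrite ?mulr1 ?mulr0 => <-; ring.
  apply: le_trans (step' _ _ i (zr k) (zr k.+1) E2) _.
  rewrite E eqxx mul1r ler_wpM2l//.
  by have := mx_norm_coord (x - y) i; rewrite !mxE.
have := H d (leqnn d); suff -> : z d = x by [].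
by apply/rowP => j; rewrite mxE ltn_ord.
Unshelve. all: by end_near. Qed.
End SmoothCompositions.

(** * Smooth functions and sections on manifolds *)

(** Induction over a compact space. The complements of the sets satisfying [P] form a filter, proper
    if [P] fails for the whole space; a cluster point of it would contradict the local
    hypothesis. *)
Lemma compact_locally (T : topologicalType) (P : set T -> Prop) :
  (forall S S' : set T, S `<=` S' -> P S' -> P S) ->
  P set0 ->
  (forall S S' : set T, P S -> P S' -> P (S `|` S')) ->
  (forall p : T, exists2 S, nbhs p S & P S) ->
  compact [set: T] -> P [set: T].
Proof.
move=> PS P0 PU Ploc cT; apply: contrapT => NP.
pose F : set_system T := [set A | P (~` A)].
have FF : ProperFilter F.
  split; first by rewrite /F /= setC0.
  split; rewrite /F /=.
  - by rewrite setCT.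
  - by move=> A B PA PB; have := PU _ _ PA PB; rewrite -setCI.
  - by move=> A B AB; apply: PS; exact: subsetC.
have [p [_ clp]] := cT F FF (@filterT _ F _).
have [S Sp PSS] := Ploc p.
have FS : F (~` S) by rewrite /F /= setCK.
by have [q []] := clp _ _ FS Sp.
Qed.

Section SmoothFunctions.
Context {R : realType} {d : nat} {M : smooth_manifold R d}.
Implicit Types (U W : set M) (f h : M -> R).

Lemma smooth_fun_pointwise U f :
  (forall p, U p -> exists2 W, W p & smooth_fun W f) -> smooth_fun U f.
Proof.
move=> H c cA r; apply: Ck_on_pointwise => x [cx Ux].
have [W Wp sW] := H _ Ux.
by exists (chart_trace c W) => //; exact: sW.
Qed.

Lemma smooth_fun_sub U W f : W `<=` U -> smooth_fun U f -> smooth_fun W f.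
Proof. by move=> WU sf; apply: smooth_fun_pointwise => p /WU Up; exists U. Qed.

Lemma smooth_fun_add U f h : open U -> smooth_fun U f -> smooth_fun U h ->
  smooth_fun U (fun p => f p + h p).
Proof.
move=> oU sf sh c cA r.
by apply: (Ck_on_add _ (sf c cA r) (sh c cA r)); exact: chart_trace_open.
Qed.

Lemma smooth_fun_mul U f h : open U -> smooth_fun U f -> smooth_fun U h ->
  smooth_fun U (fun p => f p * h p).
Proof.
move=> oU sf sh c cA r.
by apply: (Ck_on_mul _ (sf c cA r) (sh c cA r)); exact: chart_trace_open.
Qed.

Lemma smooth_fun_opp U f : open U -> smooth_fun U f ->
  smooth_fun U (fun p => - f p).
Proof.
move=> oU sf; have := smooth_fun_mul oU (smooth_fun_cst U (-1)) sf.
by apply: smooth_fun_ext => // p _; rewrite /= mulN1r.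
Qed.

Lemma smooth_fun_sum U (I : Type) (s : seq I) (Q : pred I) (F : I -> M -> R) :
  open U -> (forall i, smooth_fun U (F i)) ->
  smooth_fun U (fun p => \sum_(i <- s | Q i) F i p).
Proof.
move=> oU sF; elim: s => [|i s IH].
  by apply: smooth_fun_ext (smooth_fun_cst U 0) => // p _; rewrite big_nil.
case Qi : (Q i); last first.
  by apply: smooth_fun_ext IH => // p _; rewrite big_cons Qi.
apply: smooth_fun_ext (smooth_fun_add oU (sF i) IH) => // p _.
by rewrite big_cons Qi.
Qed.

Lemma smooth_fun_flat U f : open U -> smooth_fun U f ->
  smooth_fun U (fun p => flat 1 (f p)).
Proof.
move=> oU sf c cA.
exact: (smooth_on_flat (chart_trace_open oU) (sf c cA)).
Qed.

Lemma smooth_fun_powR a U f : open U -> (forall p, U p -> 0 < f p) ->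
  smooth_fun U f -> smooth_fun U (fun p => f p `^ a).
Proof.
move=> oU f0 sf c cA.
apply: (smooth_on_powR (f := f \o chart_inv c) a (chart_trace_open oU)).
  by move=> x [_ /f0].
exact: sf.
Qed.

Lemma smooth_fun_continuous U f p : smooth_fun U f -> U p ->
  {for p, continuous f}.
Proof.
move=> sf Up; have [c cA cp] := atlas_cover p.
have [imc invc] := chart_funP cp.
have fc : {for c p, continuous (f \o chart_inv c)}.
  have [+ _] := sf c cA 0; apply; split => //=.
  by rewrite /preimage /= invc.
have : {for p, continuous ((f \o chart_inv c) \o c)}.
  apply: continuous_comp => //; exact: chart_fun_continuous.
rewrite /prop_for /continuous_at /= invc; apply: cvg_trans.
apply: near_eq_cvg; near=> q; have cq : chart_dom c q.
  by near: q; apply: open_nbhs_nbhs; split => //; exact: chart_dom_open.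
by have [_ E] := chart_funP cq; rewrite /= E.
Unshelve. all: by end_near. Qed.

Lemma smooth_fun_chart (c c' : chart R M d) (j : 'I_d) : atlas c ->
  smooth_fun (chart_dom c) (fun p => c p 0 j).
Proof. by move=> cA c1 c1A; exact: (atlas_compat c1A cA 0 j). Qed.

(** In a chart take [expR (- 1/q)] with [q = rho^2 - |x - x0|^2], and extend by zero. The set [C] is
    the image of a compact ball, hence closed because the manifold is Hausdorff, and this makes the
    extension smooth. *)
Lemma smooth_bump (W : set M) (p0 : M) : open W -> W p0 ->
  exists psi : M -> R, exists C : set M,
    [/\ closed C /\ C `<=` W, smooth_fun setT psi, forall p, 0 <= psi p,
        0 < psi p0 & forall p, ~ C p -> psi p = 0].
Proof.
move=> oW Wp0; have [c cA cp0] := atlas_cover p0.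
have [imc invc] := chart_funP cp0.
set x0 := c p0 in imc invc.
have tx0 : chart_trace c W x0 by split => //=; rewrite /preimage /= invc.
have /nbhs_normP[r /= r0 rB] : nbhs x0 (chart_trace c W).
  by apply: open_nbhs_nbhs; split => //; exact: chart_trace_open.
pose rho := r / 2.
have rho0 : 0 < rho by rewrite divr_gt0.
have rhor : rho < r by rewrite /rho; lra.
pose D := [set x : 'rV[R]_d | `|x0 - x| <= rho].
have DW : D `<=` chart_trace c W.
  by move=> x /= xD; apply: rB; exact: le_lt_trans xD _.
have Dcl : closed D.
  have -> : D = closed_ball x0 rho by rewrite closed_ballE.
  exact: closed_ball_closed.
have Dc : compact D.
  apply: bounded_closed_compact => //.
  exists (`|x0| + rho); split; first exact: num_real.
  move=> y xy x /= xD; rewrite (le_trans _ (ltW xy))//.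
  have := ler_normB x0 (x0 - x); rewrite opprB addrC subrK => /le_trans; apply.
  by rewrite lerD2l.
pose C := chart_inv c @` D.
have Ccl : closed C.
  apply: compact_closed; first exact: manifold_hausdorff.
  apply: continuous_compact => //.
  apply: continuous_in_subspaceT => x; rewrite inE => /DW[cx _].
  exact: chart_inv_continuous.
(* The Euclidean distance is used because its square is smooth; it dominates the max norm, so
   [0 < q p] puts [c p] in the ball [D]. *)
pose q p := rho ^+ 2 - \sum_(j < d) (c p 0 j - x0 0 j) ^+ 2.
have qC p : chart_dom c p -> 0 < q p -> C p.
  move=> cp qp; have [icp invp] := chart_funP cp.
  exists (c p) => //; apply: ltW; apply: mx_norm_lt => // j.
  have : (c p 0 j - x0 0 j) ^+ 2 < rho ^+ 2.
    apply: le_lt_trans (_ : \sum_(j < d) (c p 0 j - x0 0 j) ^+ 2 < _);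
      last by move: qp; rewrite subr_gt0.
    rewrite (bigD1 j)//= lerDl; apply: sumr_ge0 => i _; exact: sqr_ge0.
  move=> H; rewrite !mxE distrC -(@ltr_pXn2r _ 2)// ?nnegrE ?(ltW rho0)//.
  by rewrite real_normK ?num_real.
pose psi p := if `[< chart_dom c p >] then flat 1 (q p) else 0.
have psi0 p : ~ C p -> psi p = 0.
  move=> nC; rewrite /psi; case: asboolP => // cp.
  rewrite /flat; case: ifPn => // qp.
  by case: nC; exact: qC.
exists psi, C; split => //.
- split=> // _ [x /DW[_ Wx] <-] //.
- apply: smooth_fun_pointwise => p _.
  have [Cp|nCp] := pselect (C p); last first.
    exists (~` C) => //; apply: smooth_fun_ext (smooth_fun_cst _ 0).
      exact: closed_openC.
    by move=> s /psi0.
  exists (chart_dom c).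
    by case: Cp => x /DW[cx _] <-; have [] := chart_invP cx.
  have oc := chart_dom_open c.
  apply: (smooth_fun_ext (f := fun p => flat 1 (q p))) => //.
    by move=> s cs; rewrite /psi asboolT.
  apply: smooth_fun_flat => //; apply: smooth_fun_add => //.
    exact: smooth_fun_cst.
  apply: smooth_fun_opp => //; apply: smooth_fun_sum => // j.
  have sj : smooth_fun (chart_dom c) (fun p => c p 0 j - x0 0 j).
    apply: smooth_fun_add => //; last exact: smooth_fun_cst.
    exact: smooth_fun_chart.
  by apply: smooth_fun_ext (smooth_fun_mul oc sj sj) => // s _; rewrite expr2.
- move=> p; rewrite /psi; case: asboolP => // _.
  by rewrite /flat; case: ifP => // _; rewrite hornerE mul1r expR_ge0.
- rewrite /psi asboolT// /flat /q big1 ?subr0; last first.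
    by move=> j _; rewrite subrr expr0n.
  by rewrite exprn_gt0// hornerE mul1r expR_gt0.
Qed.

End SmoothFunctions.

(** * Inner products on a single vector space *)

Section InnerProduct.
Context {R : realType} {V : lmodType R} (g : {dot V for idfun}).
Implicit Types (v w : V) (a : R).

Lemma dotC v w : g v w = g w v.
Proof. by rewrite hermitian_subproof expr0 mul1r. Qed.

Lemma dotDl v w x : g (v + w) x = g v x + g w x.
Proof. exact: linearDl. Qed.

Lemma dotDr v w x : g x (v + w) = g x v + g x w.
Proof. exact: linearDr. Qed.

Lemma dotZl a v x : g (a *: v) x = a * g v x.
Proof. exact: linearZl_LR. Qed.

Lemma dotZr a v x : g x (a *: v) = a * g x v.
Proof. by rewrite dotC dotZl dotC. Qed.

Lemma dotNl v x : g (- v) x = - g v x.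
Proof. by rewrite -scaleN1r dotZl mulN1r. Qed.

Lemma dotNr v x : g x (- v) = - g x v.
Proof. by rewrite dotC dotNl dotC. Qed.

Lemma dot0l x : g 0 x = 0.
Proof. exact: linear0l. Qed.

Lemma dot_suml (I : Type) (r : seq I) (P : pred I) (F : I -> V) x :
  g (\sum_(i <- r | P i) F i) x = \sum_(i <- r | P i) g (F i) x.
Proof. exact: linear_sumlz. Qed.

Lemma dot_sumr (I : Type) (r : seq I) (P : pred I) (F : I -> V) x :
  g x (\sum_(i <- r | P i) F i) = \sum_(i <- r | P i) g x (F i).
Proof. exact: linear_sumr. Qed.

Lemma dot_gt0 v : v != 0 -> 0 < g v v.
Proof. exact: neq0_dnorm_gt0. Qed.

End InnerProduct.

(** * Trivializations and smooth sections of the bundle *)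

Section Trivializations.
Context {R : realType} {M : topologicalType} {E : M -> vectType R} {k : nat}.
Implicit Types (s t : trivialization E k) (p : M).

Lemma triv_lker0 t p : triv_dom t p -> lker (t p) == 0%VS.
Proof. by move=> /triv_bij tbij; apply/lker0P; exact: bij_inj. Qed.

Lemma trivK t p : triv_dom t p -> cancel (t p) ((t p)^-1)%VF.
Proof. by move=> tp v; rewrite lker0_lfunK// triv_lker0. Qed.

Lemma trivVK t p : triv_dom t p -> cancel ((t p)^-1)%VF (t p).
Proof.
by move=> tp x; have [h _ th] := triv_bij tp; rewrite -{1}(th x) trivK// th.
Qed.

Lemma transitionE s t p x : triv_dom s p ->
  t p ((s p)^-1%VF x) = x *m transition s t p.
Proof.
move=> sp; rewrite {1}(row_sum_delta x) !linear_sum /= mulmx_sum_row.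
apply: eq_bigr => i _; rewrite !linearZ /=; congr (_ *: _).
by apply/rowP => j; rewrite !mxE.
Qed.

End Trivializations.

Section Sections.
Context {R : realType} {d : nat} {M : smooth_manifold R d} {k : nat}.
Variable E : vector_bundle M k.
Implicit Types (U W : set M) (sigma tau : forall p, E p).

Definition smooth_section_on U sigma : Prop :=
  forall t : trivialization E k, triv t ->
    smooth_mx (U `&` triv_dom t) (fun p => t p (sigma p)).

Lemma smooth_section_onT sigma : smooth_section_on setT sigma ->
  smooth_section sigma.
Proof. by move=> H t tE; have := H t tE; rewrite setTI. Qed.

Lemma smooth_section_on_pointwise U sigma :
  (forall p, U p -> exists2 W, W p & smooth_section_on W sigma) ->
  smooth_section_on U sigma.
Proof.
move=> H t tE i j; apply: smooth_fun_pointwise => p [Up tp].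
by have [W Wp sW] := H p Up; exists (W `&` triv_dom t) => //; exact: sW.
Qed.

Lemma smooth_section_on_sub U W sigma : W `<=` U ->
  smooth_section_on U sigma -> smooth_section_on W sigma.
Proof.
by move=> WU sU; apply: smooth_section_on_pointwise => p /WU Up; exists U.
Qed.

Lemma smooth_section_on_ext U sigma tau : open U ->
  (forall p, U p -> sigma p = tau p) ->
  smooth_section_on U sigma -> smooth_section_on U tau.
Proof.
move=> oU st sU t tE i j; apply: smooth_fun_ext (sU t tE i j).
  by apply: openI => //; exact: triv_dom_open.
by move=> p [Up _]; rewrite st.
Qed.

Lemma smooth_section_on0 U : smooth_section_on U (fun=> 0).
Proof.
move=> t tE i j; have := smooth_fun_cst (U `&` triv_dom t) 0.
by congr smooth_fun; apply/funext => p; rewrite linear0 mxE.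
Qed.

Lemma smooth_section_on_add U sigma tau : open U ->
  smooth_section_on U sigma -> smooth_section_on U tau ->
  smooth_section_on U (fun p => sigma p + tau p).
Proof.
move=> oU ss st t tE i j.
have oUt : open (U `&` triv_dom t) by apply: openI => //; exact: triv_dom_open.
apply: smooth_fun_ext (smooth_fun_add oUt (ss t tE i j) (st t tE i j)) => //.
by move=> p _; rewrite linearD mxE.
Qed.

Lemma smooth_section_on_scale U (f : M -> R) sigma : open U ->
  smooth_fun U f -> smooth_section_on U sigma ->
  smooth_section_on U (fun p => f p *: sigma p).
Proof.
move=> oU sf ss t tE i j.
have oUt : open (U `&` triv_dom t) by apply: openI => //; exact: triv_dom_open.
have sf' : smooth_fun (U `&` triv_dom t) f by apply: smooth_fun_sub sf => p [].
apply: smooth_fun_ext (smooth_fun_mul oUt sf' (ss t tE i j)) => //.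
by move=> p _; rewrite linearZ mxE.
Qed.

Lemma smooth_section_on_sum U (I : Type) (r : seq I) (Q : pred I)
    (F : I -> forall p, E p) : open U ->
  (forall i, smooth_section_on U (F i)) ->
  smooth_section_on U (fun p => \sum_(i <- r | Q i) F i p).
Proof.
move=> oU sF; elim: r => [|i r IH].
  apply: smooth_section_on_ext (smooth_section_on0 U) => // p _.
  by rewrite big_nil.
case Qi : (Q i); last first.
  by apply: smooth_section_on_ext IH => // p _; rewrite big_cons Qi.
apply: smooth_section_on_ext (smooth_section_on_add oU (sF i) IH) => // p _.
by rewrite big_cons Qi.
Qed.

Lemma smooth_section_on_triv (s : trivialization E k) (x : 'rV[R]_k) :
  triv s -> smooth_section_on (triv_dom s) (fun p => (s p)^-1%VF x).
Proof.
move=> sE t tE i j; rewrite (ord1 i).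
have ost : open (triv_dom s `&` triv_dom t).
  by apply: openI; exact: triv_dom_open.
apply: (smooth_fun_ext (f := fun p => \sum_l x 0 l * transition s t p l j)) => //.
  by move=> p [sp _]; rewrite transitionE// mxE.
apply: smooth_fun_sum => // l; apply: smooth_fun_mul => //.
  exact: smooth_fun_cst.
exact: triv_atlas_compat.
Qed.

Lemma smooth_section_on_extend (W C : set M) (psi : M -> R) sigma :
  open W -> closed C -> C `<=` W -> smooth_fun setT psi ->
  (forall p, ~ C p -> psi p = 0) -> smooth_section_on W sigma ->
  smooth_section_on setT (fun p => psi p *: sigma p).
Proof.
move=> oW cC CW spsi psi0 ss; apply: smooth_section_on_pointwise => p _.
have [Cp|nCp] := pselect (C p).
  exists W; first exact: CW.
  by apply: smooth_section_on_scale => //; apply: smooth_fun_sub spsi.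
exists (~` C) => //.
apply: smooth_section_on_ext (smooth_section_on0 _); first exact: closed_openC.
by move=> q /psi0 ->; rewrite scale0r.
Qed.

Variable g : riemannian_structure E.

(** In a trivialization the inner product is a quadratic expression in the coordinates of the two
    sections, whose coefficients are the smooth Gram entries of the coordinate basis. *)
Lemma smooth_metric U sigma tau : open U ->
  smooth_section_on U sigma -> smooth_section_on U tau ->
  smooth_fun U (fun p => g p (sigma p) (tau p)).
Proof.
move=> oU ss st; apply: smooth_fun_pointwise => p Up.
have [t tE tp] := triv_cover E p.
exists (U `&` triv_dom t) => //.
have oUt : open (U `&` triv_dom t) by apply: openI => //; exact: triv_dom_open.
pose e p i : E p := (t p)^-1%VF (delta_mx 0 i).
apply: (smooth_fun_ext (f := fun p => \sum_i \sum_j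
   t p (sigma p) 0 i * t p (tau p) 0 j * g p (e p i) (e p j))) => //.
  move=> q [_ tq].
  have D (v : E q) : v = \sum_i t q v 0 i *: e q i.
    apply: (can_inj (trivK tq)); rewrite linear_sum /= [LHS]row_sum_delta.
    by apply: eq_bigr => i _; rewrite linearZ /= trivVK.
  rewrite [in RHS](D (sigma q)) [in RHS](D (tau q)).
  rewrite dot_suml; apply: eq_bigr => i _.
  rewrite dot_sumr; apply: eq_bigr => j _.
  by rewrite dotZl dotZr mulrA.
apply: smooth_fun_sum => // i; apply: smooth_fun_sum => // j.
apply: smooth_fun_mul => //; last first.
  apply: smooth_fun_sub (metric_smooth g tE _ _); exact: subIsetr.
by apply: smooth_fun_mul => //; [exact: ss|exact: st].
Qed.

End Sections.

(** * Local and global frames *)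

Section Coordinates.
Context {R : realType} {M : topologicalType} {E : M -> vectType R} {k : nat}.
Variables (t : trivialization E k) (p : M) (g : {dot (E p) for idfun}).
Hypothesis tp : triv_dom t p.

(** Right multiplication by this matrix turns the coordinates of [v] into its inner products with
    the [e i], so orthogonality becomes matrix algebra. *)
Let A m (e : 'I_m -> E p) : 'M[R]_(k, m) :=
  \matrix_(l, i) g ((t p)^-1%VF (delta_mx 0 l)) (e i).

Let mulA m (e : 'I_m -> E p) v : t p v *m A e = \row_i g v (e i).
Proof.
have D : v = \sum_l t p v 0 l *: (t p)^-1%VF (delta_mx 0 l).
  apply: (can_inj (trivK tp)); rewrite linear_sum /= [LHS]row_sum_delta.
  by apply: eq_bigr => i _; rewrite linearZ /= trivVK.
apply/rowP => i; rewrite !mxE [in RHS]D dot_suml.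
by apply: eq_bigr => l _; rewrite !mxE dotZl.
Qed.

Lemma exists_orthogonal m (e : 'I_m -> E p) : (m < k)%N ->
  exists2 v, v != 0 & forall i, g v (e i) = 0.
Proof.
move=> mk; have K0 : kermx (A e) != 0.
  rewrite -mxrank_eq0 mxrank_ker -lt0n subn_gt0.
  exact: leq_ltn_trans (rank_leq_col _) mk.
have [x /sub_kermxP xA x0] : exists2 x : 'rV_k, (x <= kermx (A e))%MS & x != 0.
  by exists (nz_row (kermx (A e))); [exact: nz_row_sub|rewrite nz_row_eq0].
exists ((t p)^-1%VF x).
  by apply: contra_neq x0 => /(congr1 (t p)); rewrite trivVK// linear0.
move=> i; have := mulA e ((t p)^-1%VF x); rewrite trivVK// xA.
by move/rowP/(_ i); rewrite !mxE.
Qed.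

(** Orthonormality says that the coordinate matrix of [e] is a left inverse of the square matrix
    [A e], which is therefore invertible. The error of the expansion is orthogonal to every [e i],
    so [A e] kills its coordinates and it is zero. *)
Lemma orthonormal_expand (e : 'I_k -> E p) :
  (forall i j, g (e i) (e j) = (i == j)%:R) ->
  forall v, \sum_i g v (e i) *: e i = v.
Proof.
move=> eo v; have TA : (\matrix_i t p (e i)) *m A e = 1%:M.
  apply/row_matrixP => i; rewrite row_mul rowK mulA; apply/rowP => j.
  by rewrite !mxE eo.
have [_ uA] := mulmx1_unit TA.
apply/eqP; rewrite -subr_eq0; apply/eqP; set w := _ - v.
suff : t p w = 0 by move/(congr1 ((t p)^-1)%VF); rewrite trivK// linear0.
apply: (can_inj (mulmxK uA)); rewrite mul0mx mulA; apply/rowP => j.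
rewrite !mxE /w dotDl dotNl dot_suml (bigD1 j)//= dotZl eo eqxx mulr1.
by rewrite big1 ?addr0 ?subrr// => i ij; rewrite dotZl eo (negbTE ij) mulr0.
Qed.

End Coordinates.

Lemma powR_Nhalf (R : realType) (x : R) : 0 < x ->
  x `^ (- 2^-1) * x `^ (- 2^-1) * x = 1.
Proof.
move=> x0; rewrite -powRD; last by rewrite (gt_eqF x0) implybT.
have -> : - 2^-1 + - 2^-1 = -1 :> R by field.
by rewrite powR_inv1 ?(ltW x0)// mulVf// gt_eqF.
Qed.

Section Frames.
Context {R : realType} {d : nat} {M : smooth_manifold R d} {k : nat}.
Context {E : vector_bundle M k}.
Variable g : riemannian_structure E.

(** Gram-Schmidt, one section at a time: a vector at [p0] orthogonal to the earlier sections is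
    extended with constant coordinates, projected, and normalized after shrinking the
    neighbourhood. *)
Lemma local_orthonormal_sections (p0 : M) (m : nat) : (m <= k)%N ->
  exists (W : set M) (e : nat -> forall p, E p),
    [/\ open W, W p0, forall i, (i < m)%N -> smooth_section_on W (e i) &
      forall p, W p -> forall i j, (i < m)%N -> (j < m)%N ->
        g p (e i p) (e j p) = (i == j)%:R].
Proof.
elim: m => [_|m IH mk].
  by exists setT, (fun=> fun=> 0); split => //; exact: openT.
have [W [e [oW Wp0 se eo]]] := IH (ltnW mk).
have [t tE tp0] := triv_cover E p0.
have [v v0 ve] := exists_orthogonal (g p0) tp0 (fun i : 'I_m => e i p0) mk.
pose s p : E p := (t p)^-1%VF (t p0 v).
pose s' p : E p := s p - \sum_(i < m) g p (s p) (e i p) *: e i p.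
have oWt : open (W `&` triv_dom t) by apply: openI => //; exact: triv_dom_open.
have ss : smooth_section_on (W `&` triv_dom t) s.
  by apply: smooth_section_on_sub (smooth_section_on_triv _ tE); exact: subIsetr.
have se' (i : 'I_m) : smooth_section_on (W `&` triv_dom t) (e i).
  by apply: smooth_section_on_sub (se i (ltn_ord i)); exact: subIsetl.
have ss' : smooth_section_on (W `&` triv_dom t) s'.
  apply: smooth_section_on_add => //.
  pose F (i : 'I_m) p : E p := (- g p (s p) (e i p)) *: e i p.
  apply: (smooth_section_on_ext (sigma := fun p => \sum_i F i p)) => //.
    by move=> p _; rewrite -sumrN; apply: eq_bigr => i _; rewrite /F scaleNr.
  apply: smooth_section_on_sum => // i; apply: smooth_section_on_scale => //.
  by apply: smooth_fun_opp => //; exact: smooth_metric.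
pose q p := g p (s' p) (s' p).
have sq : smooth_fun (W `&` triv_dom t) q by exact: smooth_metric.
(* At [p0] the projection subtracts nothing, since [v] is orthogonal to all [e i p0]. *)
have q0 : 0 < q p0.
  have sv : s p0 = v by rewrite /s trivK.
  rewrite /q /s' sv big1 ?subr0; first exact: dot_gt0.
  by move=> i _; rewrite ve scale0r.
have : nbhs p0 [set p | (W `&` triv_dom t) p /\ 0 < q p].
  apply: filterI; first exact: open_nbhs_nbhs.
  have qc := smooth_fun_continuous sq (conj Wp0 tp0).
  exact: (qc _ (lt_nbhsr q0)).
rewrite nbhsE => -[W' [oW' W'p0] W'W].
have W'Wt : W' `<=` W `&` triv_dom t by move=> p /W'W[].
pose e' i p : E p := if i == m then q p `^ (- 2^-1) *: s' p else e i p.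
exists W', e'; split => //.
  move=> i; rewrite ltnS leq_eqVlt; have [-> _|im /= ilt] := eqVneq i m.
    rewrite /e' eqxx; apply: smooth_section_on_scale => //.
      apply: smooth_fun_powR => //; first by move=> p /W'W[].
      exact: smooth_fun_sub sq.
    exact: smooth_section_on_sub ss'.
  rewrite /e' (negbTE im); apply: smooth_section_on_sub (se _ ilt).
  by move=> p /W'Wt[].
move=> p W'p; have [[Wp tp] qp] := W'W _ W'p.
have s'e j : (j < m)%N -> g p (s' p) (e j p) = 0.
  move=> jm; rewrite /s' dotDl dotNl dot_suml (bigD1 (Ordinal jm))//= dotZl.
  rewrite eo// eqxx mulr1 big1 ?addr0 ?subrr// => i ij.
  rewrite dotZl eo// -[j]/(val (Ordinal jm)) (inj_eq val_inj).
  by rewrite (negbTE ij) mulr0.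
move=> i j; rewrite !ltnS (leq_eqVlt i) (leq_eqVlt j) /e'.
have [-> _|im /= ilt] := eqVneq i m; have [-> _|jm /= jlt] := eqVneq j m.
- by rewrite dotZl dotZr mulrA powR_Nhalf// eqxx.
- by rewrite dotZl s'e// mulr0.
- by rewrite dotZr dotC s'e// mulr0 (negbTE im).
- exact: eo.
Qed.

Lemma local_orthonormal_frame (p0 : M) :
  exists (W : set M) (e : 'I_k -> forall p, E p),
    [/\ open W, W p0, forall i, smooth_section_on W (e i),
      forall p, W p -> forall i j, g p (e i p) (e j p) = (i == j)%:R &
      forall p, W p -> forall v : E p, \sum_i g p v (e i p) *: e i p = v].
Proof.
have [W [e [oW Wp0 se eo]]] := local_orthonormal_sections p0 (leqnn k).
have eo' p (i j : 'I_k) : W p -> g p (e i p) (e j p) = (i == j)%:R.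
  by move=> Wp; rewrite eo.
exists W, (fun i : 'I_k => e i); split => //.
- by move=> i; exact: se.
- by move=> p Wp i j; exact: eo'.
move=> p Wp v; have [t tE tp] := triv_cover E p.
by apply: (orthonormal_expand tp) => i j; exact: eo'.
Qed.

(* The identity A A^T = 1 for the operator A with columns f_i. *)
Definition tight_frame (I : finType) (f : I -> forall p, E p) : Prop :=
  (forall i, smooth_section_on setT (f i)) /\
  forall p (v : E p), \sum_i g p v (f i p) *: f i p = v.

(** Compactness is applied to families whose frame operator is a scalar [rho p], positive on [S].
    Joining two such families adds their scalars, so the property passes to unions; no partition of
    unity has to be normalized before the end. *)
Lemma exists_tight_frame : compact [set: M] ->
  exists N, exists f : 'I_N -> forall p, E p, tight_frame f.
Proof.
move=> cM.
pose P (S : set M) := exists (I : finType) (f : I -> forall p, E p)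
    (rho : M -> R),
  [/\ forall i, smooth_section_on setT (f i), smooth_fun setT rho,
    forall p, 0 <= rho p, forall p, S p -> 0 < rho p &
    forall p (v : E p), \sum_i g p v (f i p) *: f i p = rho p *: v].
suff [I [f [rho [sf srho _ rho0 fE]]]] : P setT.
  (* Scaling by [rho^(-1/2)] divides the frame operator by [rho]. *)
  pose c p := rho p `^ (- 2^-1).
  exists #|I|, (fun i p => c p *: f (enum_val i) p); split.
    move=> i; apply: smooth_section_on_scale => //; first exact: openT.
    by apply: smooth_fun_powR => //; exact: openT.
  move=> p v; rewrite -(big_enum_val (A := I)
    (fun i => g p v (c p *: f i p) *: (c p *: f i p))) /=.
  transitivity ((c p * c p) *: \sum_i g p v (f i p) *: f i p).
    rewrite scaler_sumr; apply: eq_bigr => i _.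
    by rewrite dotZr !scalerA; congr (_ *: _); ring.
  by rewrite fE scalerA /c powR_Nhalf ?scale1r//; exact: rho0.
apply: (compact_locally (P := P)) => //.
- move=> S S' SS' [I [f [rho [? ? ? rho0 ?]]]].
  by exists I, f, rho; split=> // p /SS'; exact: rho0.
- exists 'I_0, (fun _ _ => 0), (cst 0); split=> //.
  + by move=> i; exact: smooth_section_on0.
  + exact: smooth_fun_cst.
  + by move=> p v; rewrite big_ord0 scale0r.
- move=> S S' [I [f [rho [sf srho rho0 rhoS fE]]]].
  move=> [I' [f' [rho' [sf' srho' rho0' rhoS' fE']]]].
  exists (I + I')%type, (fun i => match i with inl i => f i | inr i => f' i end).
  exists (fun p => rho p + rho' p); split=> //.
  + by case.
  + by apply: smooth_fun_add => //; exact: openT.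
  + by move=> p; rewrite addr_ge0.
  + move=> p [/rhoS Sp|/rhoS' Sp]; first by rewrite ltr_wpDr.
    by rewrite ltr_wpDl.
  + by move=> p v; rewrite big_sumType /= fE fE' scalerDl.
move=> p0; have [W [e [oW Wp0 se eo eE]]] := local_orthonormal_frame p0.
have [psi [C [[cC CW] spsi psi_ge0 psi0 psiC]]] := smooth_bump oW Wp0.
exists [set p | 0 < psi p].
  have pc := smooth_fun_continuous spsi (I : setT p0).
  exact: (pc _ (lt_nbhsr psi0)).
(* Over the support of [psi] the [e i] are orthonormal, so this family has frame operator [psi^2];
   elsewhere it is zero. *)
exists 'I_k, (fun i p => psi p *: e i p), (fun p => psi p * psi p); split.
- by move=> i; apply: (smooth_section_on_extend oW cC CW).
- by apply: smooth_fun_mul => //; exact: openT.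
- by move=> p; rewrite mulr_ge0.
- by move=> p /= ?; rewrite mulr_gt0.
move=> p v; have [Cp|nCp] := pselect (C p); last first.
  by rewrite psiC// mul0r scale0r big1// => i _; rewrite scale0r scaler0.
rewrite -{2}(eE p (CW p Cp) v) scaler_sumr; apply: eq_bigr => i _.
by rewrite dotZr !scalerA; congr (_ *: _); ring.
Qed.

End Frames.

(** * Avoiding the range of the analysis operator *)

(** An element may have several codes, but a code determines its element, so any choice of codes is
    injective. *)
Lemma card_le_of_rel (T T' : finType) (A : {set T}) (P : T -> T' -> Prop) :
  (forall l, l \in A -> exists c, P l c) ->
  (forall l l' c, P l c -> P l' c -> l = l') -> (#|A| <= #|T'|)%N.
Proof.
move=> PE PI; have [h hP] := choice (fun l : {l | l \in A} => PE _ (valP l)).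
rewrite -card_sig; apply: (leq_card h) => l l' ll'; apply: val_inj.
by apply: PI (hP l) _; rewrite ll'; exact: hP.
Qed.

Lemma truncn_close (R : realType) (y y' : R) : 0 <= y -> 0 <= y' ->
  Num.truncn y = Num.truncn y' -> `|y - y'| < 1.
Proof.
move=> /truncn_itv H /truncn_itv H' e; move: H H'; rewrite e -natr1.
by rewrite ltr_norml; move: (_%:R) => n; lra.
Qed.

Lemma truncn_cell (R : realType) (y y' : R) (n : nat) (q : R) (i : 'I_n) :
  0 < q -> 0 <= y -> 0 <= y' ->
  Num.truncn (y * q) = i -> Num.truncn (y' * q) = i -> `|y - y'| <= q^-1.
Proof.
move=> q0 y0 y'0 yi y'i; rewrite -(ler_pM2r q0) mulVf ?gt_eqF//.
rewrite -{1}(gtr0_norm q0) -normrM mulrBl ltW//.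
by apply: truncn_close; rewrite ?mulr_ge0 ?(ltW q0)// yi y'i.
Qed.

Section Lipschitz.
Context {R : realType} {d : nat}.

(** The smallest radius and the sum of the constants serve all functions at once; [r <= 1] then
    turns the Lipschitz estimate into the bound [B]. *)
Lemma lipschitz_family (I : finType) (U : set 'rV[R]_d)
    (f : I -> 'rV[R]_d -> R) x0 :
  open U -> (forall i, Ck_on 1 U (f i)) -> U x0 ->
  exists r L B : R, [/\ 0 < r <= 1, 0 <= L, 0 <= B,
    forall i x, `|x - x0| < r -> `|f i x| <= B &
    forall i x y, `|x - x0| < r -> `|y - x0| < r ->
      `|f i x - f i y| <= L * `|x - y| ].
Proof.
move=> oU sf Ux0.
have [rr H] := choice (fun i => Ck_on_lipschitz oU (sf i) Ux0).
have [LL {}H] := choice H.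
pose r := \big[Num.min/1]_i rr i; pose L := \sum_i LL i.
have r0 : 0 < r by apply: lt_bigmin => // i _; have [] := H i.
have r1 : r <= 1 by exact: bigmin_le_id.
have L0 : 0 <= L by apply: sumr_ge0 => i _; have [] := H i.
have HL i x y : `|x - x0| < r -> `|y - x0| < r ->
      `|f i x - f i y| <= L * `|x - y|.
  have [_ LL0 _ fi] := H i => xr yr.
  have ri : r <= rr i by exact: bigmin_le.
  apply: (le_trans (fi _ _ (lt_le_trans xr ri) (lt_le_trans yr ri))).
  rewrite ler_wpM2r// /L (bigD1 i)//= lerDl; apply: sumr_ge0 => j _.
  by have [] := H j.
exists r, L, (\sum_i `|f i x0| + L); split => //.
- by rewrite r0.
- by rewrite addr_ge0// sumr_ge0.
move=> i x xr; have x0r : `|x0 - x0| < r by rewrite subrr normr0.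
have := ler_distD (f i x0) (f i x) 0; rewrite !subr0 => /le_trans; apply.
rewrite addrC lerD//; first by rewrite (bigD1 i)//= lerDl sumr_ge0.
apply: (le_trans (HL i x x0 xr x0r)); rewrite ler_piMr// ltW//.
exact: lt_le_trans xr r1.
Qed.

End Lipschitz.

Section Avoidance.
Context {R : realType} {d : nat} {M : smooth_manifold R d} {k : nat}.
Context {E : vector_bundle M k}.
Variable g : riemannian_structure E.
Variables (N : nat) (f : 'I_N -> forall p, E p).
Hypothesis fT : tight_frame g f.

(* The integer points of the cube [0, m)^N in the range of the analysis
   operator v |-> (g v (f i))_i at some point of S. *)
Let bad m (S : set M) : {set {ffun 'I_N -> 'I_m}} :=
  [set l : {ffun 'I_N -> 'I_m} | `[< exists2 p, S p & exists v : E p,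
     forall i, g p v (f i p) = (l i : nat)%:R >]].

(** A pair of a base point and a vector is coded by [d + k] cell numbers, each below a constant
    times [m]. Two lattice points with a common code differ by less than 1 in every coordinate,
    hence coincide, so counting codes counts lattice points. *)
Lemma bad_local (p0 : M) : exists2 S, nbhs p0 S &
  exists C, forall m, (0 < m)%N -> (#|bad m S| <= C * m ^ (d + k))%N.
Proof.
have [fS fE] := fT.
have [W [e [oW Wp0 se eo eE]]] := local_orthonormal_frame g p0.
have [c cA cp0] := atlas_cover p0.
have [imc invc] := chart_funP cp0.
pose T (li : 'I_k * 'I_N) p := g p (e li.1 p) (f li.2 p).
have sT li : smooth_fun W (T li).
  by apply: smooth_metric => //; apply: smooth_section_on_sub (fS _) => p.
have tx0 : chart_trace c W (c p0) by split => //; rewrite /preimage /= invc.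
have oc := chart_trace_open (c := c) oW.
have [r [L [B [/andP[r0 r1] L0 B0 TB TL]]]] :=
  lipschitz_family oc (fun li => sT li c cA 1) tx0.
pose S := [set p | [/\ W p, chart_dom c p & `|c p - c p0| < r]].
exists S.
  have H1 : nbhs p0 W by exact: open_nbhs_nbhs.
  have H2 : nbhs p0 (chart_dom c).
    by apply: open_nbhs_nbhs; split => //; exact: chart_dom_open.
  have H3 : nbhs p0 [set p | `|c p - c p0| < r].
    have := chart_fun_continuous cp0; move/cvgrPdist_lt => /(_ r r0).
    by apply: filterS => p /=; rewrite distrC.
  by apply: filterS3 H1 H2 H3 => p ? ? ?; split.
(* [K] is so large that a coordinate of the analysis operator varies by less than 1 over a cell. *)
have [K K0 KP] : exists2 K, (0 < K)%N & k%:R * (B + N.+1%:R * L) < K%:R.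
  by exists (Num.truncn (k%:R * (B + N.+1%:R * L))).+1 => //; exact: truncnS_gt.
(* The shifted base coordinates lie in [[0, 2]] and the shifted components in [[0, 2(N+1)m]];
   multiplied by [Km] and [K] they are at most [2(N+1)Km]. The added 1 makes the bound strict. *)
pose C0 := (2 * N.+1 * K + 1)%N.
exists (C0 ^ (d + k))%N => m m0.
pose Code := ({ffun 'I_d -> 'I_(C0 * m)} * {ffun 'I_k -> 'I_(C0 * m)})%type.
have -> : (C0 ^ (d + k) * m ^ (d + k))%N = #|{: Code}|.
  by rewrite -expnMn card_prod !card_ffun !card_ord expnD.
have C0P : (2 * N.+1 * K * m < C0 * m)%N by rewrite ltn_pmul2r// /C0 addn1.
have mR : 0 < m%:R :> R by rewrite ltr0n.
have KR : 0 < K%:R :> R by rewrite ltr0n.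
have NR : 1 <= N.+1%:R :> R by rewrite ler1n.
have KmR : 0 < (K%:R * m%:R) :> R by rewrite mulr_gt0.
(* Over S, a vector is coded by the cells of width 1/(K m) of the coordinates of
   its base point and the cells of width 1/K of its components in the frame e. *)
pose code (l : {ffun 'I_N -> 'I_m})
    (ab : Code) :=
  exists2 p, S p & exists2 v : E p, forall i, g p v (f i p) = (l i : nat)%:R &
    (forall j, Num.truncn ((c p 0 j - c p0 0 j + 1) * (K%:R * m%:R)) = ab.1 j) /\
    (forall j, Num.truncn ((g p v (e j p) + N.+1%:R * m%:R) * K%:R) = ab.2 j).
have xb p j : S p -> 0 <= c p 0 j - c p0 0 j + 1 /\ c p 0 j - c p0 0 j <= 1.
  move=> [_ _ /ltW/le_trans/(_ r1) pr].
  have := le_trans (mx_norm_coord (c p - c p0) j) pr.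
  by rewrite !mxE ler_norml => /andP[]; lra.
(* By the Parseval identity the squared length of [v] is the sum of the [l i ^ 2], at most
   [N m^2]. *)
have zb p (v : E p) (l : {ffun 'I_N -> 'I_m}) j : S p ->
    (forall i, g p v (f i p) = (l i : nat)%:R) ->
    `|g p v (e j p)| <= N.+1%:R * m%:R.
  move=> [Wp _ _] vl; set z := g p v (e j p).
  have z1 : z ^+ 2 <= g p v v.
    rewrite -{2}(eE p Wp v) dot_sumr (bigD1 j)//= dotZr expr2 lerDl.
    by apply: sumr_ge0 => i _; rewrite dotZr -expr2 sqr_ge0.
  have z2 : g p v v <= (N.+1%:R * m%:R) ^+ 2.
    rewrite -{2}(fE p v) dot_sumr.
    apply: (@le_trans _ _ (\sum_(i < N) m%:R ^+ 2)).
      apply: ler_sum => i _; rewrite dotZr -expr2 vl ler_pXn2r ?nnegrE//.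
      by rewrite ler_nat ltnW.
    rewrite sumr_const card_ord -[X in X <= _]mulr_natl exprMn.
    rewrite ler_wpM2r ?sqr_ge0//.
    by rewrite -natrX ler_nat (leq_trans (leqnSn N))// expnS expn1 leq_pmulr.
  rewrite -(@ler_pXn2r _ 2)// ?nnegrE ?mulr_ge0 ?ler0n//.
  by rewrite real_normK ?num_real//; exact: le_trans z1 z2.
apply: (card_le_of_rel (P := code)).
- move=> l; rewrite finset.in_set => /asboolP[p Sp [v vl]].
  have C1 j :
      (Num.truncn ((c p 0 j - c p0 0 j + 1) * (K%:R * m%:R))%R < C0 * m)%N.
    have [x0 x1] := xb p j Sp.
    rewrite truncn_lt_nat; last by rewrite mulr_ge0// ltW.
    apply: (@le_lt_trans _ _ (2 * (K%:R * m%:R))).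
      by rewrite ler_wpM2r ?(ltW KmR)//; lra.
    rewrite -!natrM ltr_nat; apply: leq_ltn_trans C0P.
    by rewrite -!mulnA leq_pmul2l// leq_pmull.
  have C2 j :
      (Num.truncn ((g p v (e j p) + N.+1%:R * m%:R) * K%:R)%R < C0 * m)%N.
    have := zb p v l j Sp vl; rewrite ler_norml => /andP[z0 z1].
    rewrite truncn_lt_nat; last by rewrite mulr_ge0 ?(ltW KR)//; lra.
    apply: (@le_lt_trans _ _ (2 * (N.+1%:R * m%:R) * K%:R)).
      by rewrite ler_wpM2r ?(ltW KR)//; lra.
    by rewrite -!natrM ltr_nat; apply: leq_ltn_trans C0P; rewrite mulnA mulnAC.
  exists ([ffun j => Ordinal (C1 j)], [ffun j => Ordinal (C2 j)]).
  by exists p => //; exists v => //; split=> j; rewrite ffunE.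
move=> l l' ab [p Sp [v vl [xa zb1]]] [p' Sp' [v' vl' [xa' zb1']]].
apply/ffunP => i; apply: val_inj => /=.
have xx : `|c p - c p'| <= (K%:R * m%:R)^-1.
  apply: mx_norm_le => [|j]; first by rewrite invr_ge0 ltW.
  have [h1 _] := xb p j Sp; have [h2 _] := xb p' j Sp'.
  have := truncn_cell KmR h1 h2 (xa j) (xa' j).
  by rewrite !mxE opprD addrACA subrr addr0 opprB addrA subrK.
have zz j : `|g p v (e j p) - g p' v' (e j p')| <= K%:R^-1.
  have := zb p v l j Sp vl; rewrite ler_norml => /andP[z0 _].
  have := zb p' v' l' j Sp' vl'; rewrite ler_norml => /andP[z0' _].
  have := truncn_cell KR _ _ (zb1 j) (zb1' j).
  by rewrite opprD addrACA subrr addr0; apply; lra.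
have lE q (w : E q) (n : {ffun 'I_N -> 'I_m}) : S q ->
    (forall i, g q w (f i q) = (n i : nat)%:R) ->
    (n i : nat)%:R = \sum_j g q w (e j q) * (T (j, i) \o chart_inv c) (c q).
  move=> [Wq cq _] wn; rewrite -wn -{1}(eE q Wq w) dot_suml /=.
  have [_ ->] := chart_funP cq.
  by apply: eq_bigr => j _; rewrite dotZl.
have : `|(l i : nat)%:R - (l' i : nat)%:R| < 1 :> R.
  rewrite (lE p v l Sp vl) (lE p' v' l' Sp' vl') -sumrB.
  apply: (le_lt_trans (ler_norm_sum _ _ _)).
  apply: (@le_lt_trans _ _
    (\sum_(j < k) (B / K%:R + N.+1%:R * L / K%:R))); last first.
    rewrite sumr_const card_ord -[X in X < _]mulr_natl -mulrDl mulrA.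
    by rewrite ltr_pdivrMr// mul1r; exact: KP.
  apply: ler_sum => j _.
  set z := g p v _; set z' := g p' v' _; set t := _ (c p); set t' := _ (c p').
  (* The first error is at most [B / K]. In the second, [z'] can be of size [(N+1)m], which the base
     cells of width [1/(Km)] compensate. *)
  have -> : z * t - z' * t' = (z - z') * t + z' * (t - t') by ring.
  apply: (le_trans (ler_normD _ _)); rewrite !normrM lerD//.
    rewrite mulrC ler_pM//; last exact: zz.
    by apply: (TB (j, i)); case: Sp.
  apply: (@le_trans _ _ ((N.+1%:R * m%:R) * (L * (K%:R * m%:R)^-1))).
    apply: ler_pM => //; first exact: zb p' v' l' j Sp' vl'.
    apply: (@le_trans _ _ (L * `|c p - c p'|)); last exact: ler_wpM2l.
    by apply: (TL (j, i)); [case: Sp|case: Sp'].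
  rewrite le_eqVlt; apply/orP; left; apply/eqP; field.
  by rewrite !gt_eqF.
rewrite ltr_norml => /andP[h1 h2]; apply/eqP; rewrite eqn_leq.
by apply/andP; split; rewrite -ltnS -(ltr_nat R) -natr1; lra.
Qed.

Lemma exists_avoiding : compact [set: M] -> (d + k < N)%N ->
  exists lam : 'I_N -> R, (forall i, 0 <= lam i) /\
    forall p (v : E p), exists i, g p v (f i p) != lam i.
Proof.
move=> cM dkN.
pose P S := exists C, forall m, (0 < m)%N -> (#|bad m S| <= C * m ^ (d + k))%N.
have badS m S S' : S `<=` S' -> bad m S \subset bad m S'.
  move=> SS'; apply/fintype.subsetP => l; rewrite !finset.in_set => /asboolP[p Sp H].
  by apply/asboolP; exists p => //; exact: SS'.
have [C HC] : P setT.
  apply: (compact_locally (P := P)) => //.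
  - move=> S S' SS' [C HC]; exists C => m m0; apply: leq_trans (HC m m0).
    by apply: subset_leq_card; exact: badS.
  - exists 0%N => m m0; rewrite mul0n leqn0 cards_eq0; apply/eqP/setP => l.
    by rewrite !finset.in_set; apply/asboolP => -[].
  - move=> S S' [C HC] [C' HC']; exists (C + C')%N => m m0; rewrite mulnDl.
    apply: leq_trans (leq_add (HC m m0) (HC' m m0)).
    apply: leq_trans (leq_card_setU _ _); apply: subset_leq_card.
    apply/fintype.subsetP => l; rewrite finset.in_setU !finset.in_set.
    move=> /asboolP[p [Sp|Sp] H].
      by apply/orP; left; apply/asboolP; exists p.
    by apply/orP; right; apply/asboolP; exists p.
  - exact: bad_local.
(* For [m = C + 1] the bad points number at most [C m^(d+k) < m^(d+k+1) <= m^N]. *)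
have : exists l, l \notin bad C.+1 setT.
  apply/existsP; rewrite -negb_forall; apply/forallP => all_bad.
  have := HC C.+1 isT.
  rewrite (_ : bad _ _ = finset.setTfor {ffun 'I_N -> 'I_C.+1}); last first.
    by apply/setP => l; rewrite all_bad finset.in_setT.
  rewrite cardsT card_ffun !card_ord leqNgt => /negP; apply.
  rewrite (@leq_trans (C.+1 ^ (d + k).+1))//; last by rewrite leq_pexp2l.
  by rewrite expnS ltn_pmul2r// expn_gt0.
move=> [l]; rewrite finset.in_set => /asboolPn nl.
exists (fun i => (l i : nat)%:R); split => // p v.
apply: contrapT => H; apply: nl; exists p => //; exists v => i.
by apply/eqP; apply: contrapT => /negP ne; apply: H; exists i.
Qed.

End Avoidance.

(** * Reducing the number of vectors *)

Section Reduction.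
Context {R : realType} {V : vectType R} (g : {dot V for idfun}) (N : nat).
Variables (f : 'I_N.+1 -> V) (u : 'I_N.+1 -> R).
Hypothesis fT : forall v, \sum_i g v (f i) *: f i = v.

Let fTs v x : \sum_i g v (f i) * g x (f i) = g v x.
Proof.
rewrite -{2}(fT v) dot_suml; apply: eq_bigr => i _.
by rewrite dotZl (dotC _ (f i)).
Qed.

Let a := \sum_i u i *: f i.

(** The analysis operator is an isometry adjoint to synthesis, so the squared distance from [u] to
    the coefficients of [a] is [1 - 2|a|^2 + |a|^2]; it is positive because they differ. *)
Lemma tight_frame_norm_lt1 : \sum_i u i ^+ 2 = 1 ->
  (exists i, g a (f i) != u i) -> g a a < 1.
Proof.
move=> u1 [i0 ne].
have : 0 < \sum_i (u i - g a (f i)) ^+ 2.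
  rewrite (bigD1 i0)//= ltr_wpDr ?sumr_ge0// => [i _|]; first exact: sqr_ge0.
  by rewrite lt_neqAle sqr_ge0 andbT eq_sym sqrf_eq0 subr_eq0 eq_sym.
have -> : \sum_i (u i - g a (f i)) ^+ 2 =
    \sum_i u i ^+ 2 - 2 * \sum_i u i * g a (f i) + \sum_i g a (f i) * g a (f i).
  rewrite mulr_sumr -sumrB -big_split /=; apply: eq_bigr => i _; ring.
rewrite u1 fTs (_ : \sum_i u i * g a (f i) = g a a); first by lra.
by rewrite {3}/a dot_sumr; apply: eq_bigr => i _; rewrite dotZr.
Qed.

Hypotheses (u1 : \sum_i u i ^+ 2 = 1) (u0 : 0 <= u ord0).

(* The matrix Q = - 1 + (u + e_0)^T (u + e_0) / (1 + u_0) is orthogonal with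
   first row u, so that Q f starts with [a]; this is the rest of Q f. *)
Definition householder (j : 'I_N) : V :=
  - f (lift ord0 j) + (u (lift ord0 j) / (1 + u ord0)) *: (a + f ord0).

Lemma householder_sum v x :
  \sum_j g v (householder j) * g x (householder j) = g v x - g v a * g x a.
Proof.
(* [S1], [S2] and [S3] are sums over the full index set, known from the Parseval identity, the
   definition of [a] and [u1], with the [ord0] term removed. *)
have S1 : \sum_j g v (f (lift ord0 j)) * g x (f (lift ord0 j)) =
    g v x - g v (f ord0) * g x (f ord0).
  by rewrite -(fTs v x) big_ord_recl addrAC subrr add0r.
have S2 y : \sum_j u (lift ord0 j) * g y (f (lift ord0 j)) =
    g y a - u ord0 * g y (f ord0).
  rewrite /a big_ord_recl dotDr dotZr addrAC subrr add0r dot_sumr.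
  by apply: eq_bigr => j _; rewrite dotZr.
have S3 : \sum_j u (lift ord0 j) ^+ 2 = 1 - u ord0 ^+ 2.
  by rewrite -u1 big_ord_recl addrAC subrr add0r.
have w0 : 1 + u ord0 != 0 by rewrite gt_eqF// ltr_wpDr.
have [b bE] : exists b, b = a + f ord0 by eexists.
have [w wE] : exists w, w = 1 + u ord0 by eexists.
rewrite -wE in w0.
have -> : \sum_j g v (householder j) * g x (householder j) =
  \sum_j g v (f (lift ord0 j)) * g x (f (lift ord0 j))
  - g x b / w * \sum_j u (lift ord0 j) * g v (f (lift ord0 j))
  - g v b / w * \sum_j u (lift ord0 j) * g x (f (lift ord0 j))
  + g v b * g x b / w ^+ 2 * \sum_j u (lift ord0 j) ^+ 2.
  rewrite !mulr_sumr -!sumrB -big_split /=; apply: eq_bigr => j _.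
  by rewrite /householder -wE -bE !dotDr !dotNr !dotZr; field.
rewrite S1 !S2 S3 bE !dotDr.
have -> : u ord0 = w - 1 by rewrite wE; ring.
by field.
Qed.

(* With kap = (1 - |a|^2)^(-1/2), the operator 1 + c a a^T applied here is the
   inverse square root of the frame operator 1 - a a^T of [householder]. *)
Definition reduced_frame (kap : R) (j : 'I_N) : V :=
  householder j + (kap ^+ 2 / (1 + kap) * g (householder j) a) *: a.

Lemma reduced_frameT (kap : R) : 0 < kap -> kap * kap * (1 - g a a) = 1 ->
  forall v, \sum_j g v (reduced_frame kap j) *: reduced_frame kap j = v.
Proof.
move=> kap0 kapE v.
(* The polarized Parseval identity is enough: it makes the reconstruction error of [v] orthogonal to
   itself. *)
suff H x : \sum_j g v (reduced_frame kap j) * g x (reduced_frame kap j) = g v x.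
  apply/eqP; rewrite -subr_eq0; apply: contraT => /(dot_gt0 g).
  set w := _ - v; rewrite {2}/w dotDr dotNr dot_sumr.
  rewrite (_ : \sum_j _ = g w v) ?subrr ?ltxx//.
  rewrite (dotC _ w) -(H w); apply: eq_bigr => j _.
  by rewrite dotZr.
set c := kap ^+ 2 / (1 + kap).
(* The operator [1 + c a a^T] is self-adjoint, so it can be moved from the frame vectors to the
   argument. *)
pose y z := z + (c * g z a) *: a.
have yE z j : g z (reduced_frame kap j) = g (y z) (householder j).
  rewrite /y /reduced_frame -/c; move: (householder j) => h.
  by rewrite dotDr dotZr dotDl dotZl (dotC _ h); ring.
under eq_bigr do rewrite !yE.
rewrite householder_sum /y !dotDl !dotZl !dotDr !dotZr (dotC _ a x).
have k1 : 1 + kap != 0 by rewrite gt_eqF// addr_gt0.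
have kn0 : kap != 0 by rewrite gt_eqF.
have -> : g a a = 1 - (kap * kap)^-1.
  have := kapE; set s := g a a => sE.
  have : (1 - s) = (kap * kap)^-1.
    by apply: (mulfI (mulf_neq0 kn0 kn0)); rewrite sE divff// mulf_neq0.
  by move=> <-; ring.
by rewrite /c; field; rewrite kn0.
Qed.

End Reduction.

Section Shrinking.
Context {R : realType} {d : nat} {M : smooth_manifold R d} {k : nat}.
Context {E : vector_bundle M k}.
Variable g : riemannian_structure E.

Lemma tight_frame_shrink N (f : 'I_N.+1 -> forall p, E p) :
  compact [set: M] -> (d + k <= N)%N -> tight_frame g f ->
  exists f' : 'I_N -> forall p, E p, tight_frame g f'.
Proof.
move=> cM dkN fT.
(* Over an empty base zero sections do; otherwise a point [q] is at hand to show [lam] nonzero. *)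
have [[q _]|noM] := pselect (exists q : M, True); last first.
  exists (fun=> fun=> 0); split=> [i|p]; first exact: smooth_section_on0.
  by case: noM; exists p.
have [lam [lam0 lamP]] := exists_avoiding fT cM dkN.
have [fS fE] := fT.
pose n2 := \sum_i lam i ^+ 2.
have n0 : 0 < n2.
  (* The zero vector over [q] has zero coefficients, so avoiding them forces some [lam i] to be
     nonzero. *)
  have [i] := lamP q 0; rewrite dot0l => li.
  rewrite /n2 (bigD1 i)//= ltr_pwDl ?sumr_ge0// => [|j _]; last exact: sqr_ge0.
  by rewrite lt_neqAle sqr_ge0 andbT eq_sym sqrf_eq0 eq_sym.
pose nu := Num.sqrt n2.
have nu0 : 0 < nu by rewrite sqrtr_gt0.
have nun0 : nu != 0 by rewrite gt_eqF.
pose u i := lam i / nu.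
have u1 : \sum_i u i ^+ 2 = 1.
  under eq_bigr do rewrite /u exprMn.
  by rewrite -mulr_suml -/n2 exprVn sqr_sqrtr ?(ltW n0)// divff ?gt_eqF.
have u0 : 0 <= u ord0 by rewrite mulr_ge0 ?invr_ge0 ?(ltW nu0).
pose a p : E p := \sum_i u i *: f i p.
have sa : smooth_section_on setT a.
  apply: smooth_section_on_sum; first exact: openT.
  move=> i; apply: smooth_section_on_scale (fS i); first exact: openT.
  exact: smooth_fun_cst.
have a1 p : 0 < 1 - g p (a p) (a p).
  rewrite subr_gt0; apply: (tight_frame_norm_lt1 (fE p)) => //.
  (* Since [lam = nu u] and ranges of the analysis operator are linear, avoiding [lam] at
     [nu *: a p] means avoiding [u] at [a p]. *)
  have [i] := lamP p (nu *: a p); rewrite dotZl => ne; exists i.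
  by apply: contra_neq ne => ->; rewrite /u mulrC divfK.
pose kap p := (1 - g p (a p) (a p)) `^ (- 2^-1).
have kap0 p : 0 < kap p by exact: powR_gt0.
have oT := @openT M.
have skap : smooth_fun setT kap.
  apply: smooth_fun_powR => //; apply: smooth_fun_add => //.
    exact: smooth_fun_cst.
  by apply: smooth_fun_opp => //; exact: smooth_metric.
exists (fun j p => reduced_frame (g p) (f ^~ p) u (kap p) j).
split=> [j|p]; last first.
  by apply: reduced_frameT => //; exact: powR_Nhalf.
pose h p : E p := householder (f ^~ p) u j.
have sh : smooth_section_on setT h.
  apply: smooth_section_on_add => //.
    apply: (smooth_section_on_ext
      (sigma := fun p => (-1 : R) *: f (lift ord0 j) p)) => //.
      by move=> p _; rewrite scaleN1r.
    by apply: smooth_section_on_scale => //; exact: smooth_fun_cst.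
  apply: smooth_section_on_scale => //; first exact: smooth_fun_cst.
  exact: smooth_section_on_add.
apply: smooth_section_on_add => //; apply: smooth_section_on_scale => //.
apply: smooth_fun_mul => //; last exact: smooth_metric.
have sk2 : smooth_fun setT (fun p => kap p ^+ 2).
  by apply: smooth_fun_ext (smooth_fun_mul oT skap skap) => // p _; rewrite expr2.
apply: smooth_fun_mul => //.
have k1 p : 0 < 1 + kap p by rewrite addr_gt0.
(* Writing the inverse as the power [-1] of a positive function gives its smoothness. *)
apply: (smooth_fun_ext (f := fun p => (1 + kap p) `^ (-1))) => //.
  by move=> p _; rewrite powR_inv1// ltW.
apply: smooth_fun_powR => //; apply: smooth_fun_add => //.
exact: smooth_fun_cst.
Qed.

Lemma tight_frame_grow N (f : 'I_N -> forall p, E p) :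
  tight_frame g f -> exists f' : 'I_N.+1 -> forall p, E p, tight_frame g f'.
Proof.
move=> [fS fE]; exists (fun i p => if unlift ord0 i is Some j then f j p else 0).
split=> [i|p v].
  by case: unliftP => [j _|_]; [exact: fS|exact: smooth_section_on0].
rewrite big_ord_recl unlift_none scaler0 add0r -[RHS]fE.
by apply: eq_bigr => i _; rewrite liftK.
Qed.

(** Start from a tight frame of some size [N]; pad it with zero sections if it is too short,
    otherwise remove vectors one by one, which is possible as long as the new size is at least
    [d + k]. *)
Lemma exists_tight_frame_size n : compact [set: M] -> (d + k <= n)%N ->
  exists f : 'I_n -> forall p, E p, tight_frame g f.
Proof.
move=> cM dkn; have [N [f fT]] := exists_tight_frame g cM.
have [Nn|nN] := leqP N n.
  rewrite -(subnK Nn); elim: (n - N)%N => [|m [f' f'T]]; first by exists f.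
  exact: tight_frame_grow f'T.
rewrite -(subnK (ltnW nN)) in f fT.
elim: (N - n)%N f fT => [|m IH] f fT; first by exists f.
have [|f' f'T] := tight_frame_shrink cM _ fT; last exact: IH f'T.
by rewrite (leq_trans dkn)// leq_addl.
Qed.

End Shrinking.

(** * From tight frames to Parseval frames and sections of the Parseval bundle *)

Section Synthesis.
Context {R : realType} {V : vectType R} (g : {dot V for idfun}) (n : nat).
Variable f : 'I_n -> V.

Definition synthesis (x : 'rV[R]_n) : V := \sum_j x 0 j *: f j.

Fact synthesis_linear : linear synthesis.
Proof.
move=> c x y; rewrite /synthesis scaler_sumr -big_split; apply: eq_bigr => j _.
by rewrite !mxE scalerDl scalerA.
Qed.

HB.instance Definition _ :=
  GRing.isLinear.Build R 'rV[R]_n V *:%R synthesis synthesis_linear.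

(** This is the adjoint of [synthesis], so the hypothesis [fE] below reads [A A^T = 1]. *)
Definition analysis (v : V) : 'rV[R]_n := \row_j g v (f j).

Fact analysis_linear : linear analysis.
Proof. by move=> c x y; apply/rowP => j; rewrite !mxE dotDl dotZl. Qed.

HB.instance Definition _ :=
  GRing.isLinear.Build R V 'rV[R]_n *:%R analysis analysis_linear.

Lemma synthesis_delta j : synthesis (delta_mx 0 j) = f j.
Proof.
rewrite /synthesis (bigD1 j)//= mxE !eqxx scale1r big1 ?addr0// => i ij.
by rewrite mxE (negbTE ij) andbF scale0r.
Qed.

Hypothesis fE : forall v, \sum_j g v (f j) *: f j = v.

Lemma synthesis_parseval : parseval_space g n (linfun synthesis).
Proof.
exists (linfun analysis).
  move=> x v; rewrite lfunE /= /synthesis dot_suml.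
  by apply: eq_bigr => j _; rewrite lfunE /= mxE dotZl dotC.
apply/lfunP => v; rewrite comp_lfunE !lfunE /= -[RHS]fE.
by apply: eq_bigr => j _; rewrite mxE.
Qed.

Lemma tight_parseval_frame : parseval_frame g f.
Proof.
move=> v; rewrite -{3}(fE v) dot_sumr; apply: eq_bigr => j _.
by rewrite dotZr -expr2 real_normK ?num_real.
Qed.

End Synthesis.

Theorem theorem4p1 (R : realType) (d k n : nat) (M : smooth_manifold R d)
    (E : vector_bundle M k) (g : riemannian_structure E) :
  compact [set: M] ->
  orientable E ->
  (d + k <= n)%N ->
  (exists A : forall p, hom_bundle n E p,
     smooth_section A /\ forall p, parseval_bundle g (A p)) /\
  (exists sigma : 'I_n -> forall p, E p,
     (forall j, smooth_section (sigma j)) /\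
     forall p, parseval_frame (g p) (fun j => sigma j p)).
Proof.
move=> cM _ dkn; have [f [fS fE]] := exists_tight_frame_size g cM dkn.
split; last first.
  exists f; split=> [j|p]; first exact: smooth_section_onT.
  exact: tight_parseval_frame.
exists (fun p => linfun (synthesis (f ^~ p))); split=> [T [t tE <-] i|p].
  (* Entry [(a, b)] of the trivialized operator is coordinate [b] of its value at the basis vector
     [a], which is the section [f a]. *)
  rewrite (ord1 i); case/mxvec_indexP => a b.
  have := smooth_section_onT (fS a) tE 0 b.
  apply: smooth_fun_ext => [|p tp]; first exact: triv_dom_open.
  by rewrite /= lfunE /= /hom_triv_fun mxvecE mxE lfunE /= synthesis_delta.
exact: synthesis_parseval.
Qed.
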